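(* Let $\Omega$ be a countably infinite set and let $\Gamma$ be the generator, with transition rates $\gamma_{i\to j}\geq 0$, of an irreducible master equation on $\Omega$ with $\sum_{i,j\in\Omega}|\Gamma^{(i,j)}|<\infty$. Assume that for every probability vector $P_0$ on $\Omega$ the net $\bigl(P^F_\infty(P_0^{[F]})\bigr)_F$ of limiting states of the finite subsystems, indexed by the finite sets $F\subseteq\Omega$ with $P_0(F)>0$ ordered by inclusion, converges in $\|\cdot\|_1$ to some probability vector $P_*$. Then the master equation is positive recurrent, and $P_*=\lim_{|F|\to\infty}P^F_\infty(P_0^{[F]})$ is its stationary and limiting solution: $\Gamma P_*=0$ and $\lim_{t\to\infty}e^{t\Gamma}P_0=P_*$ in $\|\cdot\|_1$ for every probability vector $P_0$.
   Context: $\ell^1(\Omega)$ is the space of real absolutely summable families with norm $\|X\|_1=\sum_{\omega}|X^{(\omega)}|$. A probability vector is $P\in[0,\infty)^\Omega$ with $\|P\|_1=1$; for $A\subseteq\Omega$, $P(A)=\sum_{a\in A}P^{(a)}$. Generator: given rates $\gamma_{i\to j}\ge0$ with $\gamma_{i\to i}=0$, $\Gamma^{(i,j)}=\gamma_{j\to i}$ for $i\ne j$ and $\Gamma^{(j,j)}=-\sum_{k}\gamma_{j\to k}$. The master equation is $\dot P=\Gamma P$. For finite $F\subseteq\Omega$, the generator $\Gamma^{[F]}$ of the finite subsystem is the $\Omega\times\Omega$ matrix with $(\Gamma^{[F]})^{(i,j)}=\gamma_{j\to i}$ if $i\neq j$, $i,j\in F$; $(\Gamma^{[F]})^{(j,j)}=-\sum_{f\in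 F}\gamma_{j\to f}$ if $j\in F$; all other entries $0$. For finite $F$ with $P_0(F)>0$, $P_0^{[F]}$ has entries $P_0^{(i)}/P_0(F)$ for $i\in F$ and $0$ otherwise. The limiting state is $P^F_\infty(P_0^{[F]}):=\lim_{t\to\infty}e^{t\Gamma^{[F]}}P_0^{[F]}$ (this limit always exists, the problem being finite dimensional). $\lim_{|F|\to\infty}$ denotes the limit of the net over finite sets $F$ ordered by inclusion. Irreducible: the directed graph on $\Omega$ with a link $i\to j$ whenever $\gamma_{i\to j}>0$ is strongly connected. Positive recurrent: for the continuous-time Markov chain $(X_t)$ with $\mathbb P(X_t=i\mid X_0=j)=(e^{t\Gamma})^{(i,j)}$ and every initial state $X_0=\omega_0$, the return time $t_R=\inf\{t>0:X_t=\omega_0\text{ and }X_\tau\ne\omega_0\text{ for some }\tau\in(0,t)\}$ is almost surely finite and has finite expectation. *)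

(* Defs.v *)
(* MathComp-Analysis *)
From mathcomp Require Import all_boot all_order all_algebra finmap.
From mathcomp Require Import all_classical all_reals all_analysis.
From mathcomp.analysis.showcase Require summability.

Set Implicit Arguments.
Unset Strict Implicit.
Unset Printing Implicit Defensive.

Import Order.TTheory GRing.Theory Num.Theory.
Import numFieldNormedType.Exports.

Local Open Scope classical_set_scope.
Local Open Scope ring_scope.

(* The filter of the net of finite subsets ordered by inclusion. *)
Notation totally := summability.totally.

Section L1.
Context {R : realType} {Omega : countType}.
Implicit Types (X Y : Omega -> R) (A B : Omega -> Omega -> R).

(* The unordered sum of a family: the limit of its finite partial sums along
   [totally]; it is only meaningful for summable families. *)
Definition usum X : R := summability.sum (X : Omega -> R^o).

(* Finite exactly on l^1(Omega). *)
Definition norm1 X : \bar R := (\esum_(w in [set: Omega]) `|X w|%:E)%E.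

Definition cvg1 {I : Type} (u : I -> Omega -> R) (F : set_system I) Y :=
  norm1 (u x \- Y) @[x --> F] --> 0%E.

Definition prob_vector X := (forall w, 0 <= X w) /\ norm1 X = 1%E.

Definition mass X (F : {fset Omega}) : R := \sum_(a <- F) X a.

(* P^[F]; when [mass X F = 0] this is the zero vector. *)
Definition conditioned X (F : {fset Omega}) : Omega -> R :=
  fun w => if w \in F then X w / mass X F else 0.

(* A matrix acts on column vectors: [A i j] is the entry in row i, column j. *)
Definition mulmv A X : Omega -> R := fun i => usum (fun j => A i j * X j).

Definition mulmm A B : Omega -> Omega -> R :=
  fun i j => usum (fun k => A i k * B k j).

Definition powm A (n : nat) : Omega -> Omega -> R :=
  iter n (mulmm A) (fun i j => (i == j)%:R).

(* The exponential series, entry by entry. When A is absolutely summable the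
   series converges in the operator norm of l^1(Omega), so that these are the
   entries of the operator exponential. *)
Definition expm A : Omega -> Omega -> R :=
  fun i j => limn (series (fun n => powm A n i j / n`!%:R)).

Definition semigroup A (t : R) : Omega -> Omega -> R :=
  expm (fun i j => t * A i j).

End L1.

Section MasterEquation.
Context {R : realType} {Omega : countType}.
Implicit Types (gamma : Omega -> Omega -> R) (F : {fset Omega}).

(* [gamma i j] is the rate of the transition from i to j, whereas the (i, j)
   entry of a generator is the rate from j to i. *)
Definition generator gamma : Omega -> Omega -> R :=
  fun i j => if i == j then - usum (gamma j) else gamma j i.

Definition sub_generator gamma F : Omega -> Omega -> R :=
  fun i j =>
    if (i \in F) && (j \in F) then
      if i == j then - \sum_(f <- F) gamma j f else gamma j i
    else 0.

Definition limiting_state gamma F (X : Omega -> R) : Omega -> R :=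
  fun i => lim (mulmv (semigroup (sub_generator gamma F) t) X i @[t --> +oo]).

Definition limiting_states_cvg gamma (P0 P : Omega -> R) :=
  cvg1 (fun F => limiting_state gamma F (conditioned P0 F))
       (within [set F | 0 < mass P0 F] totally) P.

Definition irreducible gamma :=
  forall i j, exists p, path (fun a b => 0 < gamma a b) i p /\ last i p = j.

End MasterEquation.

Section PositiveRecurrence.
Context {R : realType} {Omega : countType}.

(* X is a right-continuous (for the discrete topology of Omega) chain started
   at w0 whose transition probabilities are the entries of the semigroup of G.
   The last clause is the time-homogeneous Markov property
     P(X_(s+t) = i | X_s = j, X_s1 = j1, ..., X_sn = jn) = (e^(tG))^(i,j),
   for times s1, ..., sn <= s, cleared of the denominator; h is the list of
   the pairs (s_k, j_k). Only the times t >= 0 matter. *)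
Definition markov_chain (G : Omega -> Omega -> R) (w0 : Omega)
    (d : measure_display) (T : measurableType d) (P : probability T R)
    (X : R -> T -> Omega) :=
  [/\ forall (t : R) (i : Omega), 0 <= t -> measurable (X t @^-1` [set i]),
      forall (x : T) (t : R), 0 <= t -> \forall s \near t^'+, X s x = X t x,
      P (X 0 @^-1` [set w0]) = 1%E
    & forall (h : seq (R * Omega)) (s t : R) (i j : Omega),
        0 <= s -> 0 <= t -> (forall q : R * Omega, q \in h -> 0 <= q.1 <= s) ->
        let H := [set x | forall q : R * Omega, q \in h -> X q.1 x = q.2]
                 `&` X s @^-1` [set j] in
        P (H `&` X (s + t) @^-1` [set i]) = ((semigroup G t i j)%:E * P H)%E].

(* +oo when the chain never leaves and comes back to w0. *)
Definition return_time {T : Type} (X : R -> T -> Omega) (w0 : Omega) (x : T) :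
    \bar R :=
  ereal_inf [set t%:E | t in [set t : R | [/\ 0 < t, X t x = w0
    & exists2 tau : R, 0 < tau < t & X tau x <> w0]]].

Definition positive_recurrent (G : Omega -> Omega -> R) :=
  forall (w0 : Omega) (d : measure_display) (T : measurableType d)
      (P : probability T R) (X : R -> T -> Omega),
    markov_chain G w0 P X ->
    {ae P, forall x, (return_time X w0 x < +oo)%E} /\
    (\int[P]_x return_time X w0 x < +oo)%E.

End PositiveRecurrence.

(* Main.v *)
(** With lambda large, Q = 1 + Gamma / lambda is a stochastic matrix with a
    positive diagonal, and e^(t Gamma) is the mixture of the powers Q^n with
    Poisson(lambda t) weights; the same rate lambda serves every finite
    subsystem.

    Let Q pi = pi for a probability vector pi such that some state is reached
    from every state charged by pi.  If pi charges the support of P0, then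
    ||Q^n P0 - pi|| tends to 0: the vectors Q^n P0 are tight, since they are
    dominated by a multiple of pi up to a small mass, and on a tight sequence
    a suitable power Q^m moves a fixed amount of the positive and of the
    negative part of Q^n P0 - pi to one state, where they cancel.  The Poisson
    weights escape to infinity, so e^(t Gamma) P0 tends to pi as well.

    Every finite set is contained in a finite F whose subsystem is strongly
    connected, and for such F the limiting state is stationary for Gamma^[F].
    The limit P* along the net is therefore stationary for Gamma, and the
    convergence above, applied to the whole system, makes it unique and
    limiting.

    For positive recurrence the chain is observed at integer times only.  Let
    e_m(j) be the probability that the skeleton started at j avoids w0 at the
    times 1, ..., m.  Stationarity gives
    <P*, e_(m+1)> + P*(w0) e_m(w0) = <P*, e_m>, hence
    P*(w0) * sum_m e_m(w0) <= 1, which bounds the expected return time. *)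
Require Import Defs.
From mathcomp Require Import all_boot all_order all_algebra finmap.
From mathcomp Require Import all_classical all_reals all_analysis.
From mathcomp Require Import measurable_realfun ring lra.
From mathcomp.analysis.showcase Require summability.

Set Implicit Arguments.
Unset Strict Implicit.
Unset Printing Implicit Defensive.

Import Order.TTheory GRing.Theory Num.Theory.
Import numFieldNormedType.Exports.

Local Open Scope classical_set_scope.
Local Open Scope ring_scope.

(** * Absolutely summable families *)

#[local] Existing Instance summability.totally_filter.

Local Notation "\tsum_ i F" := (\esum_(i in [set: _]) F%E)
  (at level 41, i at level 0, F at level 41, only parsing) : ring_scope.

Lemma normr_max0_le {R : realDomainType} (x : R) : `|Num.max x 0| <= `|x|.
Proof.
by rewrite ger0_norm ?le_max ?lexx ?orbT// ge_max ler_norm normr_ge0.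
Qed.

Section NonnegativeSums.
Context {R : realType}.
Local Open Scope ereal_scope.

(** One inequality valid for every scalar suffices: used for [c^-1] and the scaled family it gives
    the converse, and [c = 0] is treated apart. *)
Lemma esumZl (I : choiceType) (c : R) (f : I -> \bar R) :
  (0 <= c)%R -> (forall i, 0 <= f i) ->
  \tsum_i (c%:E * f i) = c%:E * \tsum_i (f i).
Proof.
have le_c (d : R) (g : I -> \bar R) : (0 <= d)%R -> (forall i, 0 <= g i) ->
    \tsum_i (d%:E * g i) <= d%:E * \tsum_i (g i).
  move=> d0 g0; apply: ge_ereal_sup => _ [X [finX _] <-].
  rewrite fsbig_finite//= -ge0_sume_distrr//.
  apply: lee_pmul => //; first exact: sume_ge0.
  by apply: ereal_sup_ubound; exists X => //; rewrite fsbig_finite.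
move=> c0 f0; apply/eqP; rewrite eq_le le_c//=.
have [->|cn0] := eqVneq c 0%R.
  by rewrite mul0e esum_ge0// => i _; rewrite mul0e.
have {cn0}c0 : (0 < c)%R by rewrite lt_def cn0.
rewrite -lee_pdivlMl//.
have := @le_c c^-1%R (fun i => c%:E * f i).
rewrite invr_ge0 ltW// => /(_ isT); under eq_esum.
  by move=> i _; rewrite muleA -EFinM mulVf ?gt_eqF// mul1e; over.
by apply=> i; rewrite mule_ge0// lee_fin ltW.
Qed.

Lemma exchange_esum (I J : choiceType) (f : I -> J -> \bar R) :
  (forall i j, 0 <= f i j) ->
  \tsum_i (\tsum_j (f i j)) = \tsum_j (\tsum_i (f i j)).
Proof.
move=> f0; rewrite !esum_esum//.
rewrite (reindex_esum ([set: J] `*`` fun=> [set: I]) _ (fun x => (x.2, x.1)))//.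
split=> //=.
- by move=> [i1 i2] [j1 j2] /= _ _ [] -> ->.
- by move=> [i1 i2] _ /=; exists (i2, i1).
Qed.

Lemma esum_ge_term (I : choiceType) (f : I -> \bar R) i :
  (forall j, 0 <= f j) -> f i <= \tsum_j (f j).
Proof.
move=> f0; rewrite (esumID [set i])// setTI esum_set1// leeDl// esum_ge0//.
Qed.

Lemma fset_le_esum (I : choiceType) (f : I -> \bar R) (F : {fset I}) :
  (forall j, 0 <= f j) -> \sum_(i <- F) f i <= \tsum_i (f i).
Proof.
move=> f0; apply: ereal_sup_ubound; exists [set` F] => //.
by rewrite fsbig_finite//= set_fsetK.
Qed.

Lemma esum_fsupp (I : choiceType) (f : I -> \bar R) (F : {fset I}) :
  (forall j, 0 <= f j) -> (forall j, j \notin F -> f j = 0) ->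
  \tsum_i (f i) = \sum_(i <- F) f i.
Proof.
move=> f0 fF; apply/eqP; rewrite eq_le fset_le_esum// andbT.
rewrite -[F in leRHS]set_fsetK -fsbig_finite//= -esum_fset//.
rewrite [leRHS]esum_mkcond le_esum// => i _.
case: ifPn => // iF; rewrite fF//; apply: contra iF => iF; exact/mem_set.
Qed.

End NonnegativeSums.

Section Usum.
Context {R : realType}.

Section OneIndex.
Context {I : countType}.
Implicit Types (X Y : I -> R) (F : {fset I}).

Definition l1 X := (norm1 X < +oo)%E.

Lemma norm1_ge0 X : (0 <= norm1 X)%E.
Proof. by apply: esum_ge0 => i _; rewrite lee_fin. Qed.

Lemma norm1_coord X i : (`|X i|%:E <= norm1 X)%E.
Proof. exact: (@esum_ge_term _ _ (fun i => `|X i|%:E)). Qed.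

Lemma norm1_fin X : l1 X -> norm1 X \is a fin_num.
Proof. by move=> l; rewrite ge0_fin_numE// norm1_ge0. Qed.

Lemma ge0_norm1 X : (forall i, 0 <= X i) -> norm1 X = \tsum_i (X i)%:E.
Proof. by move=> X0; apply: eq_esum => i _; rewrite ger0_norm. Qed.

Lemma le_norm1 X Y : (forall i, `|X i| <= `|Y i|) -> (norm1 X <= norm1 Y)%E.
Proof. by move=> XY; apply: le_esum => i _; rewrite lee_fin. Qed.

Lemma l1_le X Y : (forall i, `|X i| <= `|Y i|) -> l1 Y -> l1 X.
Proof. by move=> XY; apply: le_lt_trans; exact: le_norm1. Qed.

Lemma l1_le_ge0 X Y : (forall i, `|X i| <= Y i) -> l1 Y -> l1 X.
Proof.
by move=> XY; apply: l1_le => i; rewrite (le_trans (XY i))// ler_norm.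
Qed.

Lemma norm1Z c X : norm1 (fun i => c * X i) = (`|c|%:E * norm1 X)%E.
Proof.
by rewrite -esumZl//; apply: eq_esum => i _; rewrite -EFinM normrM.
Qed.

Lemma l1Z c X : l1 X -> l1 (fun i => c * X i).
Proof.
move=> l; rewrite /l1 norm1Z -(fineK (norm1_fin l)) -EFinM; exact: ltry.
Qed.

Lemma norm1N X : norm1 (fun i => - X i) = norm1 X.
Proof. by apply: eq_esum => i _; rewrite normrN. Qed.

Lemma l1N X : l1 X -> l1 (fun i => - X i).
Proof. by rewrite /l1 norm1N. Qed.

Lemma le_norm1D X Y : (norm1 (fun i => X i + Y i)%R <= norm1 X + norm1 Y)%E.
Proof.
rewrite -esumD//.
by apply: le_esum => i _; rewrite -EFinD lee_fin ler_normD.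
Qed.

Lemma l1D X Y : l1 X -> l1 Y -> l1 (fun i => X i + Y i).
Proof. by move=> lX lY; apply: le_lt_trans (le_norm1D _ _) (lte_add_pinfty _ _). Qed.

Lemma l1B X Y : l1 X -> l1 Y -> l1 (fun i => X i - Y i).
Proof. by move=> lX lY; apply: l1D => //; exact: l1N. Qed.

Lemma norm1_norm X : norm1 (fun i => `|X i|) = norm1 X.
Proof. by apply: eq_esum => i _; rewrite normr_id. Qed.

Lemma l1_norm X : l1 X -> l1 (fun i => `|X i|).
Proof. by rewrite /l1 norm1_norm. Qed.

Lemma l1_fset X F : (forall i, i \notin F -> X i = 0) -> l1 X.
Proof.
move=> XF; rewrite /l1 /norm1 (@esum_fsupp _ _ _ F)//.
- by rewrite sumEFin ltry.
- by move=> i /XF ->; rewrite normr0.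
Qed.

Lemma partial_sumE X F : summability.partial_sum X F = \sum_(i <- F) X i.
Proof. by rewrite /summability.partial_sum big_seq_fsetE. Qed.

(** Partial sums of a nonnegative family grow with the finite set and stay below the supremum, so a
    single finite set within [e] of the supremum controls every larger one. *)
Let ge0_usum_cvg X : (forall i, 0 <= X i) -> l1 X ->
  summability.partial_sum (X : I -> R^o) @ summability.totally -->
    (fine (\tsum_i (X i)%:E) : R^o).
Proof.
move=> X0 lX; have fX : \tsum_i (X i)%:E \is a fin_num.
  by rewrite -ge0_norm1// norm1_fin.
have E F : (\sum_(i <- F) X i <= fine (\tsum_i (X i)%:E)).
  by rewrite -lee_fin fineK// -sumEFin fset_le_esum// => i; rewrite lee_fin.
apply/cvgrPdist_le => e e0.
have : (\tsum_i (X i)%:E - e%:E < \tsum_i (X i)%:E)%E.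
  by rewrite lteBlDr// lteDl.
move=> /ereal_sup_gt[_ [A [finA _] <-]]; rewrite fsbig_finite//= => lt_A.
exists (fset_set A) => // F /= AF.
rewrite partial_sumE ger0_norm ?subr_ge0 ?E// lerBlDr -lerBlDl.
apply: (@le_trans _ _ (\sum_(i <- fset_set A) X i)); last first.
  rewrite [leRHS](big_fsetID _ (mem (fset_set A)))/=.
  rewrite [X in _ <= X + _](_ : _ = \sum_(i <- fset_set A) X i); last first.
    apply: eq_fbigl => i; rewrite !inE/=.
    by apply/andP/idP => [[]//|iA]; split => //; exact: (fsubsetP AF).
  by rewrite lerDl sumr_ge0.
by rewrite -lee_fin -sumEFin (le_trans _ (ltW lt_A))// EFinB fineK// .
Qed.

(** [usum] is defined as a limit and is meaningful only once that limit exists; on l^1 it does,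
    because the positive and negative parts converge separately. *)
Lemma usum_cvg X : l1 X ->
  summability.partial_sum (X : I -> R^o) @ summability.totally -->
    (usum X : R^o).
Proof.
move=> lX.
have lp : l1 (fun i => Num.max (X i) 0).
  by apply: l1_le lX => i; exact: normr_max0_le.
have ln : l1 (fun i => Num.max (- X i) 0).
  by apply: l1_le lX => i; rewrite -[leRHS]normrN normr_max0_le.
have p0 i : 0 <= Num.max (X i) 0 by rewrite le_max lexx orbT.
have n0 i : 0 <= Num.max (- X i) 0 by rewrite le_max lexx orbT.
have := cvgB (ge0_usum_cvg p0 lp) (ge0_usum_cvg n0 ln).
rewrite [X in X @ _ --> _](_ : _ = summability.partial_sum (X : I -> R^o)).
  by move=> /(_ _) c; rewrite /usum /summability.sum (cvg_lim _ c).
apply/funext => F; rewrite /= !fctE !partial_sumE -sumrB; apply: eq_bigr => i _.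
by case: (leP (X i)) => x0; case: leP => ?; lra.
Qed.

Lemma usum_unique X (l : R) : l1 X ->
  summability.partial_sum (X : I -> R^o) @ summability.totally --> (l : R^o) ->
  usum X = l.
Proof. by move=> lX c; exact: (cvg_unique _ (usum_cvg lX) c). Qed.

Lemma eq_usum X Y : X =1 Y -> usum X = usum Y.
Proof. by move=> /funext ->. Qed.

Lemma usumE X : (forall i, 0 <= X i) -> l1 X -> (usum X)%:E = \tsum_i (X i)%:E.
Proof.
move=> X0 lX; rewrite (usum_unique lX (ge0_usum_cvg X0 lX)) fineK//.
by rewrite -ge0_norm1// norm1_fin.
Qed.

Lemma usumD X Y : l1 X -> l1 Y ->
  usum (fun i => X i + Y i) = usum X + usum Y.
Proof.
move=> lX lY; apply: usum_unique; first exact: l1D.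
rewrite [X in X @ _ --> _](_ : _ =
    (summability.partial_sum (X : I -> R^o)) \+
    (summability.partial_sum (Y : I -> R^o))).
  exact: cvgD (usum_cvg lX) (usum_cvg lY).
apply/funext => F /=.
by rewrite !partial_sumE big_split.
Qed.

Lemma usumZ c X : l1 X -> usum (fun i => c * X i) = c * usum X.
Proof.
move=> lX; apply: usum_unique; first exact: l1Z.
rewrite [X in X @ _ --> _](_ : _ =
    (fun F => c * summability.partial_sum (X : I -> R^o) F)).
  exact: cvgMl_tmp (usum_cvg lX).
apply/funext => F /=.
by rewrite !partial_sumE mulr_sumr.
Qed.

Lemma usumN X : l1 X -> usum (fun i => - X i) = - usum X.
Proof.
move=> lX; rewrite -mulN1r -usumZ//; apply: eq_usum => i; by rewrite mulN1r.
Qed.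

Lemma usumB X Y : l1 X -> l1 Y ->
  usum (fun i => X i - Y i) = usum X - usum Y.
Proof. by move=> lX lY; rewrite usumD ?usumN//; exact: l1N. Qed.

Lemma usum_ge0 X : (forall i, 0 <= X i) -> l1 X -> 0 <= usum X.
Proof.
by move=> X0 lX; rewrite -lee_fin usumE// esum_ge0// => i _; rewrite lee_fin.
Qed.

Lemma le_usum X Y : (forall i, X i <= Y i) -> l1 X -> l1 Y -> usum X <= usum Y.
Proof.
move=> XY lX lY; rewrite -subr_ge0 -usumB// usum_ge0 ?subr_ge0//.
- by move=> i; rewrite subr_ge0.
- exact: l1B.
Qed.

Lemma norm1E X : l1 X -> norm1 X = (usum (fun i => `|X i|))%:E.
Proof. by move=> lX; rewrite usumE//; exact: l1_norm. Qed.

Lemma le_norm_usum X : l1 X -> `|usum X| <= usum (fun i => `|X i|).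
Proof.
move=> lX; have la := l1_norm lX; have lna := l1N la.
rewrite ler_norml -usumN//; apply/andP; split; apply: le_usum => // i.
  by rewrite lerNl -normrN ler_norm.
exact: ler_norm.
Qed.

Lemma usum_ge_term X i : (forall j, 0 <= X j) -> l1 X -> X i <= usum X.
Proof.
move=> X0 lX; rewrite -lee_fin usumE//.
by rewrite (@esum_ge_term _ _ (fun j => (X j)%:E))// => j; rewrite lee_fin.
Qed.

Lemma fset_le_usum X F : (forall j, 0 <= X j) -> l1 X ->
  \sum_(i <- F) X i <= usum X.
Proof.
move=> X0 lX; rewrite -lee_fin usumE// -sumEFin.
by rewrite fset_le_esum// => j; rewrite lee_fin.
Qed.

Lemma usum_fset X F : (forall i, i \notin F -> X i = 0) ->
  usum X = \sum_(i <- F) X i.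
Proof.
move=> XF; apply: usum_unique; first exact: (l1_fset XF).
apply: cvg_near_cst; exists F => // G /= FG.
rewrite partial_sumE (big_fsetID _ (mem F))/= [X in _ + X]big1_fset ?addr0.
  apply: eq_fbigl => i; rewrite !inE/=.
  by apply/andP/idP => [[]//|iA]; split => //; exact: (fsubsetP FG).
by move=> i; rewrite !inE => /andP[_ /XF].
Qed.

Lemma usum_single X i : (forall j, j != i -> X j = 0) -> usum X = X i.
Proof.
move=> Xi; rewrite (@usum_fset _ [fset i]%fset) ?big_seq_fset1//.
by move=> j; rewrite inE => /Xi.
Qed.

Lemma usum_tail X e : (forall i, 0 <= X i) -> l1 X -> 0 < e ->
  exists F, forall G, (F `<=` G)%fset ->
    usum X - \sum_(i <- G) X i <= e.
Proof.
move=> X0 lX e0; have /cvgrPdist_le/(_ _ e0)[F _ HF] := usum_cvg lX.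
exists F => G /HF; rewrite partial_sumE.
exact/le_trans/ler_norm.
Qed.

End OneIndex.

(** * Double families and interchange of sums *)

Section TwoIndices.
Context {I J : countType}.
Variable f : I -> J -> R.
Hypothesis f_l1 : (\tsum_i (norm1 (f i)) < +oo)%E.

Lemma l1_row i : l1 (f i).
Proof.
apply: le_lt_trans f_l1; apply: (@esum_ge_term _ _ (fun i => norm1 (f i))) => j.
exact: norm1_ge0.
Qed.

Lemma l1_usum_norm : l1 (fun i => usum (fun j => `|f i j|)).
Proof.
rewrite /l1 ge0_norm1; last first.
  by move=> i; apply: usum_ge0 => //; apply: l1_norm; exact: l1_row.
rewrite (eq_esum (b := fun i => norm1 (f i)))// => i _.
by rewrite norm1E//; exact: l1_row.
Qed.

Lemma l1_usum : l1 (fun i => usum (f i)).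
Proof.
by apply: l1_le_ge0 l1_usum_norm => i; apply: le_norm_usum; exact: l1_row.
Qed.

Lemma l1_swap : (\tsum_j (norm1 (f^~ j)) < +oo)%E.
Proof. by move: f_l1; rewrite exchange_esum// => i j; rewrite lee_fin. Qed.

End TwoIndices.

(** The positive and negative parts of [f] are summable double families, and for nonnegative
    families the interchange is that of sums in [\bar R]. *)
Lemma exchange_usum {I J : countType} (f : I -> J -> R) :
  (\tsum_i (norm1 (f i)) < +oo)%E ->
  usum (fun i => usum (fun j => f i j)) = usum (fun j => usum (fun i => f i j)).
Proof.
have pos (g : I -> J -> R) : (forall i j, 0 <= g i j) ->
    (\tsum_i (norm1 (g i)) < +oo)%E ->
  usum (fun i => usum (fun j => g i j)) = usum (fun j => usum (fun i => g i j)).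
  move=> g0 lg; have lg' := l1_swap lg.
  suff : (usum (fun i => usum (g i)))%:E =
    (usum (fun j => usum (g^~ j)))%:E by case.
  rewrite !usumE//; last 4 first.
  - by move=> j; apply: usum_ge0 => //; exact: (l1_row lg').
  - exact: l1_usum lg'.
  - by move=> i; apply: usum_ge0 => //; exact: l1_row lg i.
  - exact: l1_usum lg.
  rewrite (eq_esum (b := fun i => \tsum_j (g i j)%:E)); last first.
    by move=> i _; rewrite usumE//; exact: (l1_row lg).
  rewrite [RHS](eq_esum (b := fun j => \tsum_i (g i j)%:E)); last first.
    by move=> i _; rewrite usumE//; exact: (l1_row lg').
  by rewrite exchange_esum// => i j; rewrite lee_fin.
move=> lf.
pose p i j := Num.max (f i j) 0; pose n i j := Num.max (- f i j) 0.
have lp : (\tsum_i (norm1 (p i)) < +oo)%E.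
  apply: le_lt_trans lf; apply: le_esum => i _; apply: le_norm1 => j.
  exact: normr_max0_le.
have ln : (\tsum_i (norm1 (n i)) < +oo)%E.
  apply: le_lt_trans lf; apply: le_esum => i _; apply: le_norm1 => j.
  by rewrite -[leRHS]normrN normr_max0_le.
have p0 i j : 0 <= p i j by rewrite le_max lexx orbT.
have n0 i j : 0 <= n i j by rewrite le_max lexx orbT.
have fE i j : f i j = p i j - n i j.
  by rewrite /p /n; case: (leP (f i j)) => ?; case: leP => ?; lra.
have lp' := l1_swap lp; have ln' := l1_swap ln.
transitivity (usum (fun i => usum (p i)) - usum (fun i => usum (n i))).
  rewrite -usumB; [|exact: l1_usum lp|exact: l1_usum ln].
  apply: eq_usum => i; rewrite -usumB; [|exact: l1_row lp i|exact: l1_row ln i].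
  by apply: eq_usum => j; rewrite fE.
rewrite (pos p)// (pos n)// -usumB; [|exact: l1_usum lp'|exact: l1_usum ln'].
apply: eq_usum => j; rewrite -usumB; [|exact: (l1_row lp' j)|exact: (l1_row ln' j)].
by apply: eq_usum => i; rewrite fE.
Qed.

End Usum.

(** * Stochastic matrices *)

Section ProbabilityVectors.
Context {R : realType} {I : countType}.
Implicit Types (X : I -> R) (i : I).

Lemma prob_l1 X : prob_vector X -> l1 X.
Proof. by case=> _ X1; rewrite /l1 X1 ltry. Qed.

Lemma prob_usum X : prob_vector X -> usum X = 1.
Proof.
move=> pX; have := usumE pX.1 (prob_l1 pX).
by rewrite -ge0_norm1 ?pX.2; [case|exact: pX.1].
Qed.

Lemma prob_of_usum X : (forall i, 0 <= X i) -> l1 X -> usum X = 1 ->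
  prob_vector X.
Proof. by move=> X0 lX X1; split => //; rewrite ge0_norm1// -usumE// X1. Qed.

Lemma prob_le1 X i : prob_vector X -> X i <= 1.
Proof.
by move=> pX; rewrite -(prob_usum pX) usum_ge_term//; [case: pX|exact: prob_l1].
Qed.

Lemma prob_exists_gt0 X : prob_vector X -> exists i, 0 < X i.
Proof.
move=> pX; apply: contrapT => /forallNP nX.
have X0 : X = fun=> 0.
  apply/funext => i; apply/eqP; have := pX.1 i.
  by rewrite le_eqVlt eq_sym => /orP[//|/nX].
have := prob_usum pX; rewrite X0 (@usum_fset _ _ _ fset0)// big_nil.
by move/esym/eqP; rewrite oner_eq0.
Qed.

Lemma delta_prob i : prob_vector (fun k => (k == i)%:R : R).
Proof.
have d0 k : k != i -> (k == i)%:R = 0 :> R by move/negbTE->.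
apply: prob_of_usum.
- by move=> k; rewrite ler0n.
- by apply: (@l1_fset _ _ _ [fset i]%fset) => k; rewrite inE; exact: d0.
- by rewrite (@usum_single _ _ _ i)// eqxx.
Qed.

End ProbabilityVectors.

Section StochasticMatrices.
Context {R : realType} {I : countType}.
Implicit Types (A B Q : I -> I -> R) (x y : I -> R).

(** Columns, not rows, have mass one: [Q i j] is the probability of passing from [j] to [i], in
    accordance with the action on column vectors. *)
Definition stochastic Q := forall j, prob_vector (Q^~ j).

Lemma stochastic_ge0 Q i j : stochastic Q -> 0 <= Q i j.
Proof. by move=> sQ; exact: (sQ j).1. Qed.

Lemma stochastic_le1 Q i j : stochastic Q -> Q i j <= 1.
Proof. by move=> sQ; exact: (prob_le1 i (sQ j)). Qed.

Lemma stochastic_diag_lt1 Q i j : stochastic Q -> i != j ->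
  0 < Q i j -> Q j j < 1.
Proof.
move=> sQ ij Qij; rewrite -(prob_usum (sQ j)).
apply: lt_le_trans (@fset_le_usum _ _ (Q^~ j) [fset j; i]%fset (sQ j).1 (prob_l1 (sQ j))).
by rewrite big_fsetU1 ?inE 1?eq_sym//= big_seq_fset1 ltrDl.
Qed.

Lemma stochastic1 : stochastic (fun i j => (i == j)%:R).
Proof. by move=> j; exact: delta_prob. Qed.

Section OneMatrix.
Variable Q : I -> I -> R.
Hypothesis sQ : stochastic Q.

Let Q_norm i j (r : R) : `|Q i j * r| <= `|r|.
Proof.
rewrite normrM ger0_norm ?stochastic_ge0//.
by rewrite ler_piMl ?stochastic_le1.
Qed.

Lemma l1_stochastic_row x i : l1 x -> l1 (fun j => Q i j * x j).
Proof. by apply: l1_le => j; exact: Q_norm. Qed.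

(** Each column of [Q] has norm one. The identity supplies the summability behind the interchanges
    of sums over rows and columns. *)
Lemma norm1_stochastic_col x :
  \tsum_j (norm1 (fun i => Q i j * x j)%R) = norm1 x.
Proof.
apply: eq_esum => j _.
rewrite (_ : (fun i => _) = (fun i => x j * Q i j)); last first.
  by apply/funext => i; rewrite mulrC.
by rewrite norm1Z (sQ j).2 mule1.
Qed.

Let row_sum x : l1 x -> (\tsum_i (norm1 (fun j => Q i j * x j)%R) < +oo)%E.
Proof.
move=> lx; apply: (@l1_swap _ _ _ (fun j i => Q i j * x j)).
by rewrite norm1_stochastic_col.
Qed.

Lemma l1_mulmv x : l1 x -> l1 (mulmv Q x).
Proof. by move=> lx; exact: l1_usum (row_sum lx). Qed.

Lemma usum_mulmv x : l1 x -> usum (mulmv Q x) = usum x.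
Proof.
move=> lx; rewrite (exchange_usum (row_sum lx)); apply: eq_usum => j.
rewrite (eq_usum (Y := fun i => x j * Q i j)); last by move=> i; rewrite mulrC.
by rewrite usumZ ?(prob_usum (sQ j)) ?mulr1//; exact: prob_l1 (sQ j).
Qed.

Lemma norm1_mulmv_le x : l1 x -> (norm1 (mulmv Q x) <= norm1 x)%E.
Proof.
move=> lx; have lx' := l1_norm lx.
rewrite !norm1E//; last exact: l1_mulmv.
rewrite lee_fin -[leRHS]usum_mulmv//; apply: le_usum.
- move=> i; apply: le_trans (le_norm_usum _) _; first exact: l1_stochastic_row.
  apply: le_usum.
  + by move=> j; rewrite normrM (ger0_norm (stochastic_ge0 _ _ _)).
  + by apply: l1_norm; exact: l1_stochastic_row.
  + exact: l1_stochastic_row.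
- by apply: l1_norm; exact: l1_mulmv.
- exact: l1_mulmv.
Qed.

Lemma mulmvB x y : l1 x -> l1 y ->
  mulmv Q (fun i => x i - y i) = (fun i => mulmv Q x i - mulmv Q y i).
Proof.
move=> lx ly; apply/funext => i; rewrite /mulmv -usumB.
- by apply: eq_usum => j; rewrite mulrBr.
- exact: l1_stochastic_row.
- exact: l1_stochastic_row.
Qed.

Lemma mulmvD x y : l1 x -> l1 y ->
  mulmv Q (fun i => x i + y i) = (fun i => mulmv Q x i + mulmv Q y i).
Proof.
move=> lx ly; apply/funext => i; rewrite /mulmv -usumD.
- by apply: eq_usum => j; rewrite mulrDr.
- exact: l1_stochastic_row.
- exact: l1_stochastic_row.
Qed.

Lemma mulmvZ c x : l1 x -> mulmv Q (fun i => c * x i) = (fun i => c * mulmv Q x i).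
Proof.
move=> lx; apply/funext => i; rewrite /mulmv -usumZ.
- by apply: eq_usum => j; rewrite mulrCA.
- exact: l1_stochastic_row.
Qed.

Lemma mulmv_ge0 x i : (forall j, 0 <= x j) -> l1 x -> 0 <= mulmv Q x i.
Proof.
move=> x0 lx; apply: usum_ge0; last exact: l1_stochastic_row.
by move=> j; rewrite mulr_ge0// stochastic_ge0.
Qed.

Lemma le_mulmv x y i : (forall j, x j <= y j) -> l1 x -> l1 y ->
  mulmv Q x i <= mulmv Q y i.
Proof.
move=> xy lx ly; apply: le_usum; [|exact: l1_stochastic_row..].
by move=> j; rewrite ler_wpM2l// stochastic_ge0.
Qed.

Lemma mulmv_ge_term x i j : (forall k, 0 <= x k) -> l1 x ->
  Q i j * x j <= mulmv Q x i.
Proof.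
move=> x0 lx; apply: (@usum_ge_term _ _ (fun j => Q i j * x j)).
- by move=> k; rewrite mulr_ge0// stochastic_ge0.
- exact: l1_stochastic_row.
Qed.

Lemma mulmv_prob x : prob_vector x -> prob_vector (mulmv Q x).
Proof.
move=> px; have lx := prob_l1 px; apply: prob_of_usum.
- by move=> i; apply: mulmv_ge0 => //; exact: px.1.
- exact: l1_mulmv.
- by rewrite usum_mulmv// prob_usum.
Qed.

End OneMatrix.

Lemma mulmv1 x : mulmv (fun i j => (i == j)%:R) x = x.
Proof.
apply/funext => i; rewrite /mulmv (@usum_single _ _ _ i) ?eqxx ?mul1r//.
by move=> j; rewrite eq_sym => /negbTE ->; rewrite mul0r.
Qed.

Lemma mulmv_mulmm A B x : stochastic A -> stochastic B -> l1 x ->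
  mulmv (mulmm A B) x = mulmv A (mulmv B x).
Proof.
move=> sA sB lx; apply/funext => i.
have fE : (\tsum_j (norm1 (fun k => A i k * (B k j * x j))%R) < +oo)%E.
  apply: le_lt_trans lx; rewrite -(norm1_stochastic_col sB).
  apply: le_esum => j _; apply: le_norm1 => k; rewrite [leLHS]normrM.
  by rewrite ger0_norm ?stochastic_ge0// ler_piMl// stochastic_le1.
rewrite /mulmv /mulmm.
transitivity (usum (fun j => usum (fun k => A i k * (B k j * x j)))).
  apply: eq_usum => j; rewrite mulrC -usumZ.
    by apply: eq_usum => k; rewrite mulrC mulrA.
  by apply: (l1_stochastic_row sA); exact: prob_l1 (sB j).
rewrite exchange_usum//; apply: eq_usum => k; rewrite usumZ//.
exact: (l1_stochastic_row sB).
Qed.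

Lemma stochastic_mulmm A B : stochastic A -> stochastic B ->
  stochastic (mulmm A B).
Proof. by move=> sA sB j; exact: (mulmv_prob sA (sB j)). Qed.

Lemma powmS A n : powm A n.+1 = mulmm A (powm A n).
Proof. by []. Qed.

Lemma stochastic_powm Q n : stochastic Q -> stochastic (powm Q n).
Proof.
by move=> sQ; elim: n => [|n ih]; [exact: stochastic1|exact: stochastic_mulmm].
Qed.

Section Powers.
Variable Q : I -> I -> R.
Hypothesis sQ : stochastic Q.

Lemma mulmv_powmD m n x : l1 x ->
  mulmv (powm Q (m + n)) x = mulmv (powm Q m) (mulmv (powm Q n) x).
Proof.
move=> lx; elim: m => [|m ih]; first by rewrite mulmv1.
have sP k := stochastic_powm k sQ.
by rewrite addSn !powmS !mulmv_mulmm ?ih//; exact: l1_mulmv.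
Qed.

Lemma mulmv_powm_fix n x : l1 x -> mulmv Q x = x -> mulmv (powm Q n) x = x.
Proof.
move=> lx Qx; elim: n => [|n ih]; first by rewrite mulmv1.
by rewrite powmS mulmv_mulmm ?ih//; exact: stochastic_powm.
Qed.

Lemma powm_path i (p : seq I) : path (fun a b => 0 < Q b a) i p ->
  0 < powm Q (size p) (last i p) i.
Proof.
elim/last_ind: p => [|p k ih]; first by rewrite /powm /= eqxx ltr01.
rewrite rcons_path size_rcons last_rcons => /andP[/ih {}ih lk].
apply: lt_le_trans (mulr_gt0 lk ih) _.
have sP := stochastic_powm (size p) sQ i.
by apply: (mulmv_ge_term sQ) => //; [exact: sP.1|exact: prob_l1].
Qed.

(** A positive diagonal lets the chain wait in state [i], so a positive entry stays positive in all
    higher powers. This yields one exponent common to finitely many states. *)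
Lemma powm_lazy i j m n : (forall k, 0 < Q k k) -> (m <= n)%N ->
  0 < powm Q m i j -> 0 < powm Q n i j.
Proof.
move=> Qd /subnKC <-; elim: (n - m)%N => [|d ih]; first by rewrite addn0.
move=> /ih {}ih; rewrite addnS powmS.
apply: lt_le_trans (mulr_gt0 (Qd i) ih) _.
have sP := stochastic_powm (m + d) sQ j.
by apply: (mulmv_ge_term sQ) => //; [exact: sP.1|exact: prob_l1].
Qed.

End Powers.

End StochasticMatrices.

(** * Convergence of the powers of a lazy stochastic matrix *)

Section OffFiniteSet.
Context {R : realType} {I : countType}.
Implicit Types (X Y : I -> R) (F : {fset I}).

Definition off F X : I -> R := fun j => if j \in F then 0 else X j.

Lemma norm_off_le F X i : `|off F X i| <= `|X i|.
Proof. by rewrite /off; case: ifP => // _; rewrite normr0. Qed.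

Lemma l1_off F X : l1 X -> l1 (off F X).
Proof. by apply: l1_le => i; exact: norm_off_le. Qed.

Lemma usum_off F X : l1 X -> usum X = \sum_(i <- F) X i + usum (off F X).
Proof.
move=> lX; pose Y i := if i \in F then X i else 0.
have Y0 i : i \notin F -> Y i = 0 by rewrite /Y => /negbTE ->.
rewrite -(@eq_big_seq _ _ _ _ _ Y); last by move=> i; rewrite /Y => ->.
rewrite -(usum_fset Y0) -usumD; [|exact: l1_fset Y0|exact: l1_off].
by apply: eq_usum => i; rewrite /Y /off; case: ifP; rewrite ?addr0 ?add0r.
Qed.

Lemma usum_off_le F X Y : (forall i, X i <= Y i) -> l1 X -> l1 Y ->
  usum (off F X) <= usum (off F Y).
Proof.
move=> XY lX lY; apply: le_usum; [|exact: l1_off..].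
by move=> i; rewrite /off; case: ifP.
Qed.

(** Removing from a finite set the indices where [X] vanishes leaves the mass outside it unchanged,
    so the set can be chosen within the support. *)
Lemma usum_off_small X e : (forall i, 0 <= X i) -> l1 X -> 0 < e ->
  exists F, (forall i, i \in F -> 0 < X i) /\ usum (off F X) <= e.
Proof.
move=> X0 lX e0; have [F /(_ F)] := usum_tail X0 lX e0.
rewrite fsubset_refl => /(_ isT).
rewrite (usum_off F lX) addrAC subrr add0r => Fe.
exists [fset i in F | 0 < X i]%fset; split.
  by move=> i; rewrite !inE => /andP[].
apply: le_trans Fe; apply: le_usum; [|exact: l1_off..].
move=> i; rewrite /off !inE/=; case: (i \in F) => //=.
by case: ltP.
Qed.

End OffFiniteSet.

Section DropOfDistance.
Context {R : realType} {I : countType}.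
Implicit Types (x : I -> R) (K : I -> I -> R).

Lemma l1_pos x : l1 x -> l1 (fun i => Num.max (x i) 0).
Proof. by apply: l1_le => i; exact: normr_max0_le. Qed.

Lemma l1_neg x : l1 x -> l1 (fun i => Num.max (- x i) 0).
Proof. by move=> lx; apply: (@l1_pos (fun i => - x i)); exact: l1N. Qed.

(* |a - b| = a + b - 2 min(a, b) *)
Lemma norm_mulmv_drop K x i : stochastic K -> l1 x ->
  usum (fun k => `|mulmv K x k|) +
    2 * Num.min (mulmv K (fun j => Num.max (x j) 0) i)
                (mulmv K (fun j => Num.max (- x j) 0) i)
  <= usum (fun j => `|x j|).
Proof.
move=> sK lx; have lp := l1_pos lx; have ln := l1_neg lx.
set p := fun j => Num.max (x j) 0; set n := fun j => Num.max (- x j) 0.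
have p0 j : 0 <= p j by rewrite le_max lexx orbT.
have n0 j : 0 <= n j by rewrite le_max lexx orbT.
have lKp := l1_mulmv sK lp; have lKn := l1_mulmv sK ln.
have Kp0 j : 0 <= mulmv K p j by exact: mulmv_ge0.
have Kn0 j : 0 <= mulmv K n j by exact: mulmv_ge0.
pose w k := Num.min (mulmv K p k) (mulmv K n k).
have w0 k : 0 <= w k by rewrite le_min Kp0 Kn0.
have lw : l1 w.
  apply: l1_le lKp => k; rewrite !ger0_norm//.
  by rewrite ge_min lexx.
have -> : usum (fun j => `|x j|) = usum (mulmv K p) + usum (mulmv K n).
  rewrite !usum_mulmv// -usumD//; apply: eq_usum => j.
  by rewrite /p /n; case: (leP (x j)) => ?; case: leP => ?;
    [rewrite ler0_norm|rewrite ler0_norm|rewrite ger0_norm|rewrite ger0_norm];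
    lra.
have -> : mulmv K x = fun k => mulmv K p k - mulmv K n k.
  rewrite -mulmvB//; congr mulmv; apply/funext => j.
  by rewrite /p /n; case: (leP (x j)) => ?; case: leP => ?; lra.
have -> : usum (fun k => `|mulmv K p k - mulmv K n k|) =
    usum (mulmv K p) + usum (mulmv K n) - 2 * usum w.
  rewrite -usumZ// -usumD// -usumB; [|exact: l1D|exact: l1Z].
  apply: eq_usum => k; rewrite /w; case: leP => ?;
    [rewrite ler0_norm|rewrite gtr0_norm]; lra.
have := @usum_ge_term _ _ w i w0 lw; rewrite -/(w i); lra.
Qed.

End DropOfDistance.

Section ConvergenceToStationary.
Context {R : realType} {I : countType}.
Variables (Q : I -> I -> R) (pi u : I -> R) (i0 : I).
Hypothesis sQ : stochastic Q.
Hypothesis Q_lazy : forall k, 0 < Q k k.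
Hypothesis pi_prob : prob_vector pi.
Hypothesis Qpi : mulmv Q pi = pi.
(** Reachability is asked only from the support of [pi], so that a finite subsystem, viewed as a
    matrix on all of [I] whose states outside [F] never move, is covered too. *)
Hypothesis reach_i0 : forall j, 0 < pi j -> exists n, 0 < powm Q n i0 j.
Hypothesis u_prob : prob_vector u.
Hypothesis u_supp : forall j, 0 < u j -> 0 < pi j.

Let sP n : stochastic (powm Q n).
Proof. exact: stochastic_powm. Qed.

Let lpi : l1 pi. Proof. exact: prob_l1. Qed.
Let lu : l1 u. Proof. exact: prob_l1. Qed.

(* The part of u on a finite set is at most C pi, and this bound is
   preserved by Q. *)
Let tight (e : R) : 0 < e -> exists F : {fset I},
  [/\ forall j, j \in F -> 0 < pi j, usum (off F pi) <= e
    & forall n, usum (off F (mulmv (powm Q n) u)) <= e].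
Proof.
move=> e0; have e20 : 0 < e / 2 by rewrite divr_gt0.
have [F1 [_ F1e]] := usum_off_small u_prob.1 lu e20.
(* The sum dominates every ratio [u j / pi j] on [F1]; the summand 1 gives [1 <= C], which is used
   for the tail of [pi] itself. *)
pose C := 1 + \sum_(j <- F1) u j / pi j.
have C1 : 1 <= C.
  by rewrite lerDl sumr_ge0// => j _; rewrite divr_ge0//; [exact: u_prob.1|exact: pi_prob.1].
have C0 : 0 < C by exact: lt_le_trans ltr01 C1.
pose u1 j := if j \in F1 then u j else 0.
have lu1 : l1 u1.
  by apply: l1_le lu => j; rewrite /u1; case: ifP => // _; rewrite normr0.
have u1C j : u1 j <= C * pi j.
  rewrite /u1; case: ifPn => jF; last first.
    by rewrite mulr_ge0 ?(ltW C0)//; exact: pi_prob.1.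
  have [uj|uj] := ltP 0 (u j); last first.
    by rewrite (le_trans uj)// mulr_ge0 ?(ltW C0)//; exact: pi_prob.1.
  rewrite -ler_pdivrMr ?u_supp// (le_trans _ (_ : \sum_(j <- F1) u j / pi j <= _))//.
    rewrite (big_fsetD1 j)//= lerDl sumr_ge0// => k _.
    by rewrite divr_ge0//; [exact: u_prob.1|exact: pi_prob.1].
  by rewrite lerDr.
(* This tail of [pi] will be multiplied by [C]; the other [e / 2] pays for the part of [u] outside
   [F1]. *)
have eC0 : 0 < e / 2 / C by rewrite divr_gt0.
have [F [Fpi Fe]] := usum_off_small pi_prob.1 lpi eC0.
exists F; split => //.
  apply: le_trans Fe _; rewrite ler_pdivrMr//.
  have : e <= e * C by rewrite ler_peMr// ltW.
  lra.
move=> n; have uE : u = fun j => u1 j + off F1 u j.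
  by apply/funext => j; rewrite /u1 /off; case: ifP; rewrite ?addr0 ?add0r.
have lo : l1 (off F1 u) by exact: l1_off.
have lPu2 : l1 (mulmv (powm Q n) (off F1 u)) by exact: l1_mulmv.
rewrite [X in mulmv _ X]uE mulmvD//.
apply: (@le_trans _ _ (usum (fun i =>
    C * off F pi i + mulmv (powm Q n) (off F1 u) i))).
  apply: le_usum.
  - move=> i; rewrite /off; case: ifP => _.
      rewrite mulr0 add0r; apply: mulmv_ge0 => // j.
      by rewrite /off; case: ifP => // _; exact: u_prob.1.
    rewrite lerD2r -[X in _ * X i](mulmv_powm_fix sQ n lpi Qpi).
    rewrite -[leRHS]/((fun i => C * mulmv (powm Q n) pi i) i) -mulmvZ//.
    by apply: le_mulmv => //; exact: l1Z.
  - by apply: l1_off; apply: l1D => //; exact: l1_mulmv.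
  - by apply: l1D => //; apply: l1Z; exact: l1_off.
rewrite usumD//; last by apply: l1Z; exact: l1_off.
rewrite usumZ; last exact: l1_off.
rewrite usum_mulmv// [leRHS](splitr e) lerD//.
by rewrite mulrC -ler_pdivlMr.
Qed.

(** By laziness the maximum of the exponents serves all states of [s], and [c] is then a minimum of
    finitely many positive numbers. *)
Let positive_row (s : seq I) : (forall j, j \in s -> 0 < pi j) ->
  exists m c, 0 < c /\ forall j, j \in s -> c <= powm Q m i0 j.
Proof.
move=> spi.
have [m Hm] : exists m, forall j, j \in s -> 0 < powm Q m i0 j.
  elim: s spi => [|k s ih] spi; first by exists 0%N.
  have [|m Hm] := ih; first by move=> j js; apply: spi; rewrite inE js orbT.
  have [|n Hn] := reach_i0 (j := k); first by apply: spi; rewrite mem_head.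
  exists (maxn n m) => j; rewrite inE => /orP[/eqP ->|/Hm].
    by apply: (powm_lazy sQ Q_lazy _ Hn); rewrite leq_maxl.
  by apply: (powm_lazy sQ Q_lazy); rewrite leq_maxr.
exists m; elim: s Hm {spi} => [|k s ih] Hm; first by exists 1; rewrite ltr01.
have [|c [c0 Hc]] := ih; first by move=> j js; apply: Hm; rewrite inE js orbT.
exists (Num.min c (powm Q m i0 k)); rewrite lt_min c0 Hm ?mem_head//.
split=> // j; rewrite inE => /orP[/eqP ->|/Hc]; first by rewrite ge_min lexx orbT.
by move=> cj; rewrite ge_min cj.
Qed.

Let x n i := mulmv (powm Q n) u i - pi i.
Let d n := usum (fun i => `|x n i|).

Let lPu n : l1 (mulmv (powm Q n) u). Proof. exact: l1_mulmv. Qed.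
Let lx n : l1 (x n). Proof. exact: l1B. Qed.

Let usum_x n : usum (x n) = 0.
Proof. by rewrite /x usumB// usum_mulmv// !prob_usum// subrr. Qed.

Let xD m n : x (m + n) = mulmv (powm Q m) (x n).
Proof.
apply/funext => i; rewrite /x mulmvB// mulmv_powmD//.
by rewrite (mulmv_powm_fix sQ m lpi Qpi).
Qed.

Let d_ge0 n : 0 <= d n.
Proof. by apply: usum_ge0 => //; exact: l1_norm. Qed.

Let d_decr m n : d (m + n) <= d n.
Proof.
rewrite /d xD -lee_fin -!norm1E//; first exact: norm1_mulmv_le.
exact: l1_mulmv.
Qed.

(** The positive and negative parts of [x n] both have mass [d n / 2 > L / 2]. The first is
    dominated by [Q^n u] and the second by [pi], so by tightness at most [L / 4] of each lies
    outside [F]. Hence [Q^m] brings at least [c * (L / 4)] of each to [i0], and this cancellation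
    counts twice in the norm. *)
Let d_drop (L : R) : 0 < L -> exists m c, 0 < c /\
  forall n, L < d n -> d (m + n) <= d n - c.
Proof.
move=> L0; have L40 : 0 < L / 4 by rewrite divr_gt0.
have [F [Fpi Fe Fu]] := tight L40.
have [m [c [c0 Hc]]] := positive_row Fpi.
exists m, (2 * (c * (L / 4))); split.
  by rewrite !mulr_gt0.
move=> n Ln; rewrite lerBrDr.
apply: le_trans (norm_mulmv_drop i0 (sP m) (lx n)).
rewrite /d xD lerD2l ler_pM2l//.
have key (y : I -> R) : (forall j, 0 <= y j) -> l1 y -> usum y = d n / 2 ->
    usum (off F y) <= L / 4 -> c * (L / 4) <= mulmv (powm Q m) y i0.
  move=> y0 ly yd yF; have := usum_off F ly; rewrite yd => Sy.
  apply: (@le_trans _ _ (\sum_(j <- F) powm Q m i0 j * y j)); last first.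
    apply: (@fset_le_usum _ _ (fun j => powm Q m i0 j * y j)).
      by move=> j; rewrite mulr_ge0// stochastic_ge0.
    exact: l1_stochastic_row.
  apply: (@le_trans _ _ (c * \sum_(j <- F) y j)).
    by rewrite ler_pM2l//; lra.
  rewrite mulr_sumr big_seq [leRHS]big_seq; apply: ler_sum => j jF.
  by rewrite ler_wpM2r// Hc.
have lp := l1_pos (lx n); have ln := l1_neg (lx n).
have sub : usum (fun j => Num.max (x n j) 0) = usum (fun j => Num.max (- x n j) 0).
  apply/subr0_eq; rewrite -usumB// -[RHS](usum_x n); apply: eq_usum => j.
  by case: (leP (x n j)) => ?; case: leP => ?; lra.
have add : usum (fun j => Num.max (x n j) 0) + usum (fun j => Num.max (- x n j) 0) = d n.
  rewrite -usumD//; apply: eq_usum => j.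
  by case: (leP (x n j)) => ?; case: leP => ?;
    [rewrite ler0_norm|rewrite ler0_norm|rewrite ger0_norm|rewrite ger0_norm];
    lra.
have Pu0 j : 0 <= mulmv (powm Q n) u j by apply: mulmv_ge0 => //; exact: u_prob.1.
rewrite le_min !key//.
- by move=> j; rewrite le_max lexx orbT.
- by rewrite -add sub; lra.
- apply: le_trans Fe; apply: usum_off_le => // j.
  by rewrite ge_max pi_prob.1 andbT /x; have := Pu0 j; lra.
- by move=> j; rewrite le_max lexx orbT.
- by rewrite -add sub; lra.
- apply: le_trans (Fu n); apply: usum_off_le => // j.
  by rewrite ge_max Pu0 andbT /x; have := pi_prob.1 j; lra.
Qed.

(** If the distance were still above [e] after [k] blocks of [m] steps, each block would have
    lowered it by [c]; with [k > d 0 / c] it would be negative. Afterwards the distance cannot grow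
    again. *)
Lemma powm_cvg_stationary (e : R) : 0 < e -> exists N, forall n, (N <= n)%N ->
  usum (fun i => `|mulmv (powm Q n) u i - pi i|) <= e.
Proof.
move=> e0; have [m [c [c0 Hc]]] := d_drop e0.
pose k := Num.bound (d 0 / c).
exists (k * m)%N => n /subnK <-; apply: le_trans (d_decr _ _) _.
rewrite leNgt; apply/negP => dk.
have dj j : (j <= k)%N -> d (j * m) <= d 0 - j%:R * c.
  elim: j => [|j ih] jk; first by rewrite mul0r subr0.
  have {}ih := ih (ltnW jk).
  have /Hc : e < d (j * m).
    apply: lt_le_trans dk _.
    by rewrite -(subnK (ltnW jk)) mulnDl d_decr.
  rewrite -mulSn => /le_trans; apply.
  by rewrite -natr1 mulrDl mul1r; lra.
have := dj k (leqnn k); have := d_ge0 (k * m).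
have : d 0 / c < k%:R.
  by apply: archi_boundP; rewrite divr_ge0 ?d_ge0 ?ltW.
rewrite ltr_pdivrMr//; lra.
Qed.

End ConvergenceToStationary.

(** * Mixtures of stochastic matrices *)

Section SumsOverNat.
Context {R : realType}.
Implicit Types (X : nat -> R).

Let fset_below n : {fset nat} := [fset k in iota 0 n]%fset.

Let sum_fset_below X n : \sum_(k <- fset_below n) X k = \sum_(0 <= k < n) X k.
Proof.
apply: perm_big; apply: uniq_perm; rewrite ?fset_uniq ?iota_uniq// => k.
by rewrite !inE /= mem_index_iota mem_iota add0n.
Qed.

(** Initial segments eventually contain any given finite set, so the limit along all finite sets is
    also the sum of the series. *)
Lemma usum_series X : l1 X -> series X @ \oo --> usum X.
Proof.
move=> lX; apply/cvgrPdist_le => e e0.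
have /cvgrPdist_le/(_ _ e0)[F _ HF] := usum_cvg lX.
exists (\max_(k <- F) k).+1 => // n /= Fn.
rewrite /series/= -sum_fset_below -partial_sumE; apply: HF => /=.
apply/fsubsetP => k kF; rewrite !inE /= mem_iota add0n/=.
by apply: leq_ltn_trans Fn; exact: (@leq_bigmax_seq _ (enum_fset F) xpredT id k kF isT).
Qed.

Lemma lim_series_usum X : l1 X -> limn (series X) = usum X.
Proof. by move=> lX; apply: cvg_lim => //; exact: usum_series. Qed.

Lemma l1_ord X n : (forall k, (n <= k)%N -> X k = 0) -> l1 X.
Proof.
move=> Xn; apply: (@l1_fset _ _ _ (fset_below n)) => k.
by rewrite !inE /= mem_iota add0n -leqNgt => /Xn.
Qed.

Lemma usum_ord X n : (forall k, (n <= k)%N -> X k = 0) ->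
  usum X = \sum_(k < n) X k.
Proof.
move=> Xn; rewrite (@usum_fset _ _ _ (fset_below n)).
  by rewrite sum_fset_below big_mkord.
by move=> k; rewrite !inE /= mem_iota add0n -leqNgt => /Xn.
Qed.

Lemma l1_series X M : (forall n, \sum_(0 <= k < n) `|X k| <= M) -> l1 X.
Proof.
move=> XM; apply: (@le_lt_trans _ _ M%:E); last exact: ltry.
rewrite /norm1 -nneseries_esumT//; apply: lime_le.
  exact: is_cvg_nneseries.
by apply: nearW => n; rewrite sumEFin lee_fin.
Qed.

Lemma l1_exp_coeff (x : R) : l1 (exp_coeff x).
Proof.
apply: (@l1_series _ (expR `|x|)) => n.
have -> : \sum_(0 <= k < n) `|exp_coeff x k| = series (exp_coeff `|x|) n.
  rewrite /series/=; apply: eq_bigr => k _.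
  by rewrite !exp_coeffE normrM normrX ger0_norm// invr_ge0 ler0n.
apply: nondecreasing_cvgn_le; last exact: is_cvg_series_exp_coeff.
apply: nondecreasing_series => k _ _; exact: exp_coeff_ge0.
Qed.

Lemma usum_exp_coeff (x : R) : usum (exp_coeff x) = expR x.
Proof. by rewrite -lim_series_usum//; exact: l1_exp_coeff. Qed.

(** This recurrence for [x^n / n!] drives both the bound [poisson_le] and the expansion
    [powm_centered]. *)
Lemma exp_coeffS (x : R) n : x * exp_coeff x n = n.+1%:R * exp_coeff x n.+1.
Proof.
rewrite !exp_coeffE /= factS natrM invfM exprS.
by rewrite mulrCA !mulrA divff ?pnatr_eq0// mul1r.
Qed.

Lemma l1_geometric (a : R) : 0 <= a -> a < 1 -> l1 (fun n => a ^+ n).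
Proof.
move=> a0 a1; apply: (@l1_series _ (1 - a)^-1) => n.
rewrite (eq_bigr (fun k => a ^+ k)); last first.
  by move=> k _; rewrite ger0_norm// exprn_ge0.
rewrite -[leRHS]mulr1 ler_pdivlMl ?subr_gt0// big_mkord.
by rewrite -opprB mulNr -subrX1 opprB lerBlDr lerDl exprn_ge0.
Qed.

(** With this delay a Cauchy product becomes a double family on all pairs [(n, k)]; after the sums
    are exchanged, summing over [n] makes the delay disappear. *)
Definition shift k X n := if (k <= n)%N then X (n - k)%N else 0.

Lemma norm1_shift k X : norm1 (shift k X) = norm1 X.
Proof.
transitivity (\esum_(n in [set n | (k <= n)%N]) `|X (n - k)%N|%:E)%E.
  rewrite [RHS]esum_mkcond; apply: eq_esum => n _; rewrite /shift.
  have [kn|nk] := boolP (k <= n)%N; first by rewrite mem_set.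
  by rewrite memNset ?normr0//; exact/negP.
rewrite (reindex_esum [set: nat] _ (addn^~ k)).
  by apply: eq_esum => n _; rewrite addnK.
split => //=.
- by move=> n _; exact: leq_addl.
- by move=> m n _ _ /addIn.
- by move=> n /= kn; exists (n - k)%N => //; rewrite subnK.
Qed.

Lemma usum_shift k X : l1 X -> usum (shift k X) = usum X.
Proof.
move=> lX; have lS : l1 (shift k X) by rewrite /l1 norm1_shift.
have := usum_series lS; rewrite -(cvg_shiftn k).
have -> : [sequence series (shift k X) (n + k)%N]_n = series X.
  apply/funext => n; rewrite /series/= (big_cat_nat (n := k))//=; last exact: leq_addl.
  rewrite big_nat_cond big1 ?add0r; last first.
    by move=> i /andP[/andP[_ ik] _]; rewrite /shift leqNgt ik.
  rewrite -{1}[k]add0n big_addn addnK; apply: eq_bigr => i _.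
  by rewrite /shift leq_addl addnK.
by move=> c; exact: (cvg_unique _ c (usum_series lX)).
Qed.

End SumsOverNat.

(** * Averages of stochastic matrices with probability weights *)

Section Mixture.
Context {R : realType} {I : countType}.
Variables (p : nat -> R) (P : nat -> I -> I -> R).
Hypothesis p_prob : prob_vector p.
Hypothesis P_stoch : forall n, stochastic (P n).

Definition mixture i j := usum (fun n => p n * P n i j).

Let lp : l1 p. Proof. exact: prob_l1. Qed.
Let p0 n : 0 <= p n. Proof. exact: p_prob.1. Qed.

Let l1_scaled (c : nat -> R) (M : R) : (forall n, `|c n| <= M) ->
  l1 (fun n => p n * c n).
Proof.
move=> cM; apply: (@l1_le_ge0 _ _ _ (fun n => M * p n)); last exact: l1Z.
by move=> n; rewrite normrM ger0_norm// mulrC ler_wpM2r.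
Qed.

Let mixture_term_l1 i j : l1 (fun n => p n * P n i j).
Proof.
apply: (@l1_scaled _ 1) => n.
by rewrite ger0_norm ?stochastic_ge0 ?stochastic_le1.
Qed.

Let sum_usum (c : nat -> I -> R) (M : R) :
  (forall n, (norm1 (c n) <= M%:E)%E) ->
  (\tsum_n (norm1 (fun i => p n * c n i)%R) < +oo)%E.
Proof.
move=> cM; apply: (@le_lt_trans _ _ (\tsum_n (M%:E * (p n)%:E))).
  apply: le_esum => n _; rewrite norm1Z ger0_norm// muleC.
  by apply: lee_wpmul2r => //; rewrite lee_fin.
rewrite esumZl.
- by rewrite -ge0_norm1// p_prob.2 mule1 ltry.
- by rewrite -lee_fin (le_trans _ (cM 0%N))// norm1_ge0.
- by move=> n; rewrite lee_fin.
Qed.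

Lemma mixture_gt0 n i j :
  0 < p n -> 0 < P n i j -> 0 < mixture i j.
Proof.
move=> pn Pn; apply: lt_le_trans (mulr_gt0 pn Pn) _.
apply: (@usum_ge_term _ _ (fun n => p n * P n i j)) => [m|].
  by rewrite mulr_ge0// stochastic_ge0.
exact: mixture_term_l1.
Qed.

Lemma stochastic_mixture : stochastic mixture.
Proof.
move=> j.
have S : (\tsum_n (norm1 (fun i => p n * P n i j)%R) < +oo)%E.
  by apply: (@sum_usum (fun n i => P n i j) 1) => n; rewrite (P_stoch n j).2.
apply: prob_of_usum.
- move=> i; apply: usum_ge0 => // n.
  by rewrite mulr_ge0// stochastic_ge0.
- exact: l1_usum (l1_swap S).
- rewrite -exchange_usum// -(prob_usum p_prob); apply: eq_usum => n.
  rewrite usumZ ?(prob_usum (P_stoch n j)) ?mulr1//.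
  exact: prob_l1 (P_stoch n j).
Qed.

Lemma mulmv_mixture x i : l1 x ->
  mulmv mixture x i = usum (fun n => p n * mulmv (P n) x i).
Proof.
move=> lx.
have S : (\tsum_n (norm1 (fun j => p n * (P n i j * x j))%R) < +oo)%E.
  apply: (@sum_usum (fun n j => P n i j * x j) (fine (norm1 x))) => n.
  rewrite fineK ?norm1_fin//; apply: le_norm1 => j.
  by rewrite normrM ler_piMl// ger0_norm ?stochastic_ge0 ?stochastic_le1.
transitivity (usum (fun j => usum (fun n => p n * (P n i j * x j)))).
  apply: eq_usum => j; rewrite mulrC -usumZ//.
  by apply: eq_usum => n; rewrite mulrC mulrA.
rewrite -exchange_usum//; apply: eq_usum => n; rewrite usumZ//.
exact: l1_stochastic_row.
Qed.

Lemma mulmv_mixture_fix x : l1 x -> (forall n, mulmv (P n) x = x) ->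
  mulmv mixture x = x.
Proof.
move=> lx Px; apply/funext => i; rewrite mulmv_mixture//.
rewrite (eq_usum (Y := fun n => x i * p n)).
  by rewrite usumZ// prob_usum// mulr1.
by move=> n; rewrite Px mulrC.
Qed.

(** The triangle inequality for the average; it passes from convergence of the powers to convergence
    of the semigroup. *)
Lemma norm1_mulmv_mixture_le x : l1 x ->
  (norm1 (mulmv mixture x) <=
    \tsum_n ((p n)%:E * norm1 (mulmv (P n) x)))%E.
Proof.
move=> lx.
have S : (\tsum_n (norm1 (fun i => p n * mulmv (P n) x i)%R) < +oo)%E.
  apply: (@sum_usum (fun n i => mulmv (P n) x i) (fine (norm1 x))) => n.
  by rewrite fineK ?norm1_fin//; exact: norm1_mulmv_le.
apply: (@le_trans _ _ (\tsum_n (norm1 (fun i => p n * mulmv (P n) x i)%R))).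
  rewrite exchange_esum//; apply: le_esum => i _.
  rewrite mulmv_mixture//; have lS := l1_row (l1_swap S) i.
  by rewrite -/(norm1 (fun n => p n * mulmv (P n) x i)) norm1E// lee_fin le_norm_usum.
by apply: le_esum => n _; rewrite norm1Z ger0_norm.
Qed.

End Mixture.

(** * Uniformization *)

(** Convergence in [cvg1] takes place in the extended reals; a bound by a real [e] already forces
    the norm to be finite, so the epsilon form is equivalent. *)
Lemma cvg1P {R : realType} {I : countType} {T : Type} (u : T -> I -> R)
    (F : set_system T) (Y : I -> R) : Filter F ->
  cvg1 u F Y <->
  forall e, 0 < e -> \forall x \near F, (norm1 (u x \- Y)%R <= e%:E)%E.
Proof.
move=> FF; split.
- move=> /fine_cvgP[fin /cvgrPdist_le cv] e e0.
  move: (cv _ e0); apply: filterS2 fin => x fx.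
  rewrite sub0r normrN /= ger0_norm ?fine_ge0 ?norm1_ge0// => xe.
  by rewrite -(fineK fx) lee_fin.
- move=> H; apply/fine_cvgP.
  have le_fin x e : (norm1 (u x \- Y)%R <= e%:E)%E -> norm1 (u x \- Y) \is a fin_num.
    by move=> /le_lt_trans xe; apply: norm1_fin; apply: xe; exact: ltry.
  split; first by apply: filterS (H 1 ltr01) => x /le_fin.
  apply/cvgrPdist_le => e e0; apply: filterS (H e e0) => x xe.
  rewrite sub0r normrN /= ger0_norm ?fine_ge0 ?norm1_ge0//.
  by rewrite -lee_fin fineK//; exact: le_fin xe.
Qed.

(** Meant for the orbit of a stationary vector under the semigroup: being constant, it can only
    converge to that vector. *)
Lemma cvg1_cst_unique {R : realType} {I : countType} (Y Z : I -> R) (u : R -> I -> R) :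
  (forall t, 0 <= t -> u t = Y) -> cvg1 u +oo Z -> Y = Z.
Proof.
move=> uY /cvg1P cv; apply/funext => i; apply/eqP; rewrite -subr_eq0.
rewrite -normr_le0; apply/ler_addgt0Pl => e e0; rewrite addr0.
have [t [t0 te]] := filter_ex (filterI (nbhs_pinfty_ge (num_real 0)) (cv e e0)).
by move: te; rewrite uY// -lee_fin; exact/le_trans/(norm1_coord (_ \- _)).
Qed.

(** * Poisson weights *)

Section Poisson.
Context {R : realType}.
Implicit Types s : R.

Definition poisson s (n : nat) : R := expR (- s) * exp_coeff s n.

Lemma poisson_prob s : 0 <= s -> prob_vector (poisson s).
Proof.
move=> s0; apply: prob_of_usum.
- by move=> n; rewrite mulr_ge0 ?expR_ge0 ?exp_coeff_ge0.
- by apply: l1Z; exact: l1_exp_coeff.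
- rewrite usumZ; last exact: l1_exp_coeff.
  by rewrite usum_exp_coeff -expRD addNr expR0.
Qed.

(** By [exp_coeffS], [s] times the weight at [n] is [n + 1] times the weight at [n + 1], which is at
    most 1. So each fixed weight vanishes as [s] grows. *)
Lemma poisson_le s n : 0 < s -> poisson s n <= n.+1%:R / s.
Proof.
move=> s0; rewrite ler_pdivlMr// /poisson -mulrA [_ * s]mulrC exp_coeffS.
rewrite mulrCA ler_piMr ?ler0n//.
apply: prob_le1 n.+1 (poisson_prob (ltW s0)).
Qed.

Lemma poisson_gt0 s n : 0 < s -> 0 < poisson s n.
Proof.
move=> s0; rewrite mulr_gt0 ?expR_gt0// exp_coeffE.
by rewrite mulr_gt0 ?exprn_gt0// invr_gt0 ltr0n fact_gt0.
Qed.

End Poisson.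

Lemma mulmv_generator {R : realType} {I : countType} (Q G : I -> I -> R)
    (lam : R) (x : I -> R) i :
  stochastic Q -> (forall i j, G i j = lam * (Q i j - (i == j)%:R)) -> l1 x ->
  mulmv G x i = lam * (mulmv Q x i - x i).
Proof.
move=> sQ GE lx; pose z j := (i == j)%:R * x j.
have zi j : j != i -> z j = 0.
  by rewrite /z eq_sym => /negbTE ->; rewrite mul0r.
have lz : l1 z by apply: (@l1_fset _ _ _ [fset i]%fset) => j; rewrite inE => /zi.
have -> : x i = usum z by rewrite (usum_single zi) /z eqxx mul1r.
have lQ := l1_stochastic_row sQ i lx.
rewrite -usumB// -usumZ; last exact: l1B.
by apply: eq_usum => j; rewrite GE /z; ring.
Qed.

Section Uniformization.
Context {R : realType} {I : countType}.
Variables (Q : I -> I -> R) (s : R).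
Hypothesis sQ : stochastic Q.

Let M i j := s * (Q i j - (i == j)%:R).

Let sP n : stochastic (powm Q n). Proof. exact: stochastic_powm. Qed.

Lemma mulmv_sum n (c : nat -> R) (X : nat -> I -> R) : (forall k, l1 (X k)) ->
  l1 (fun i => \sum_(k < n) c k * X k i) /\
  mulmv Q (fun i => \sum_(k < n) c k * X k i) =
  (fun i => \sum_(k < n) c k * mulmv Q (X k) i).
Proof.
move=> lX; elim: n => [|n [ihl ih]].
  have z (f : I -> 'I_0 -> R) : (fun i => \sum_(k < 0) f i k) = fun=> 0.
    by apply/funext => i; rewrite big_ord0.
  rewrite !z; split; first by apply: (@l1_fset _ _ _ fset0).
  apply/funext => i; rewrite /mulmv (@usum_fset _ _ _ fset0) ?big_seq_fset0// => j _.
  by rewrite mulr0.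
have S : (fun i => \sum_(k < n.+1) c k * X k i) =
    (fun i => \sum_(k < n) c k * X k i + c n * X n i).
  by apply/funext => i; rewrite big_ord_recr.
have lcX : l1 (fun i => c n * X n i) by exact: l1Z.
rewrite S; split; first exact: l1D.
rewrite mulmvD// ih mulmvZ//.
by apply/funext => i; rewrite big_ord_recr.
Qed.

Let mulmv_centered y i : l1 y -> mulmv M y i = s * (mulmv Q y i - y i).
Proof. exact: mulmv_generator. Qed.

(** The binomial expansion of [s^n (Q - 1)^n], arranged as [n!] times the [n]-th term of the Cauchy
    product of the series for [e^(-s)] and [e^(s Q)]. *)
Lemma powm_centered n i j : powm M n i j =
  n`!%:R * \sum_(k < n.+1)
    exp_coeff (- s) (n - k)%N * (exp_coeff s k * powm Q k i j).
Proof.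
elim: n i => [|n ih] i.
  by rewrite big_ord1 subnn !exp_coeffE /= fact0 !expr0 invr1 !mul1r.
pose c (m k : nat) := exp_coeff (- s) (m - k)%N * exp_coeff s k.
pose v k i := powm Q k i j.
pose y i := \sum_(k < n.+1) c n k * v k i.
have [ly Qy] := @mulmv_sum n.+1 (c n) v (fun k => prob_l1 (sP k j)).
have -> : powm M n.+1 i j = mulmv M (fun i => n`!%:R * y i) i.
  rewrite powmS /mulmm /mulmv; apply: eq_usum => k; rewrite ih /y.
  by do 2 congr (_ * _); apply: eq_bigr => l _; rewrite /c /v mulrA.
rewrite mulmv_centered; last exact: l1Z.
rewrite mulmvZ// Qy factS natrM /y.
transitivity (n`!%:R * \sum_(k < n.+2) n.+1%:R * (c n.+1 k * v k i)); last first.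
  rewrite -mulr_sumr mulrA [in RHS](mulrC n.+1%:R); congr (_ * _).
  by apply: eq_bigr => k _; rewrite /c /v mulrA.
(* This splitting plays the role of Pascal's rule: by [exp_coeffS] the first share gives the terms
   produced by [s Q] and the second those produced by [- s]. The first share vanishes at [k = 0],
   the second at [k = n + 1]. *)
have split_n (k : 'I_n.+2) : n.+1%:R * (c n.+1 k * v k i) =
    k%:R * (c n.+1 k * v k i) + (n.+1 - k)%N%:R * (c n.+1 k * v k i).
  by rewrite -mulrDl -natrD subnKC// -ltnS.
rewrite (eq_bigr _ (fun k _ => split_n k)) big_split/=.
rewrite [X in _ = _ * (X + _)]big_ord_recl/= mul0r add0r.
rewrite [X in _ = _ * (_ + X)]big_ord_recr/=.
rewrite subnn mul0r addr0 -mulrBr mulrCA; congr (_ * _).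
rewrite mulrBr !mulr_sumr -sumrN; congr (_ + _); apply: eq_bigr => k _.
  rewrite -[mulmv Q (v k) i]/(powm Q k.+1 i j) /c /v /bump /= add1n subSS.
  have := exp_coeffS s k => E.
  transitivity (exp_coeff (- s) (n - k)%N * (s * exp_coeff s k) *
      mulmm Q (powm Q k) i j).
    by ring.
  by rewrite E; ring.
have kn : (k <= n)%N by rewrite -ltnS.
rewrite /c subSn//; have := exp_coeffS (- s) (n - k)%N => E.
transitivity (- s * exp_coeff (- s) (n - k)%N * (exp_coeff s k * v k i)).
  by ring.
by rewrite E; ring.
Qed.

(** The exponential series of [M] is the Cauchy product of the two series in [powm_centered].
    Absolute summability allows summing over [n] first, which leaves the factor [expR (- s)] in
    front of [exp_coeff s k], a Poisson weight. *)
Lemma expm_uniformization : expm M = mixture (poisson s) (powm Q).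
Proof.
apply/funext => i; apply/funext => j.
pose a := exp_coeff (- s); pose b k := exp_coeff s k * powm Q k i j.
pose g n k := shift k (fun m => b k * a m) n.
have la : l1 a by exact: l1_exp_coeff.
have lb : l1 b.
  apply: l1_le (l1_exp_coeff s) => k; rewrite normrM ler_piMr//.
  by rewrite ger0_norm ?stochastic_ge0 ?stochastic_le1.
have S : (\tsum_k (norm1 (g^~ k)) < +oo)%E.
  rewrite (eq_esum (b := fun k => (fine (norm1 a))%:E * `|b k|%:E)%E).
    by rewrite esumZl ?fine_ge0 ?norm1_ge0// -/(norm1 b) -(fineK (norm1_fin lb)) ltry.
  by move=> k _; rewrite norm1_shift norm1Z fineK ?norm1_fin// muleC.
have S' := l1_swap S.
rewrite /expm (_ : (fun n => _) = (fun n => usum (g n))); last first.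
  apply/funext => n; rewrite powm_centered mulrAC divff ?mul1r; last first.
    by rewrite pnatr_eq0 -lt0n fact_gt0.
  rewrite (@usum_ord _ _ n.+1); last by move=> k; rewrite /g /shift ltnNge => /negbTE->.
  apply: eq_bigr => k _.
  by rewrite /g /shift -ltnS ltn_ord mulrC.
rewrite lim_series_usum; last exact: l1_usum S'.
rewrite exchange_usum//; apply: eq_usum => k.
rewrite usum_shift; last exact: l1Z.
rewrite usumZ// usum_exp_coeff /b /poisson; ring.
Qed.

End Uniformization.

(** * The semigroup of [lam (Q - 1)] and its limit at infinity *)

Section LongTimeLimit.
Context {R : realType} {I : countType}.
Variables (Q : I -> I -> R) (lam : R) (G : I -> I -> R).
Hypothesis sQ : stochastic Q.
Hypothesis lam0 : 0 < lam.
Hypothesis GE : forall i j, G i j = lam * (Q i j - (i == j)%:R).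

Let sP n : stochastic (powm Q n). Proof. exact: stochastic_powm. Qed.

Lemma semigroup_mixture t :
  semigroup G t = mixture (poisson (lam * t)) (powm Q).
Proof.
rewrite -expm_uniformization// /semigroup; congr expm.
by apply/funext => i; apply/funext => j; rewrite GE mulrCA mulrA.
Qed.

Lemma stochastic_semigroup t : 0 <= t -> stochastic (semigroup G t).
Proof.
move=> t0; rewrite semigroup_mixture; apply: stochastic_mixture => //.
by apply: poisson_prob; rewrite mulr_ge0// ltW.
Qed.

Lemma semigroup_fix t x : 0 <= t -> l1 x -> mulmv Q x = x ->
  mulmv (semigroup G t) x = x.
Proof.
move=> t0 lx Qx; rewrite semigroup_mixture; apply: mulmv_mixture_fix => //.
  by apply: poisson_prob; rewrite mulr_ge0// ltW.
by move=> n; exact: mulmv_powm_fix.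
Qed.

(** In the Poisson average of the distances between [Q^n u] and [pi], the terms [n >= N] contribute
    at most [e / 2] in total. The first [N] distances are at most [A], and their weights sum to at
    most [C / s]. *)
Lemma semigroup_cvg (pi u : I -> R) (i0 : I) :
  (forall k, 0 < Q k k) -> prob_vector pi -> mulmv Q pi = pi ->
  (forall j, 0 < pi j -> exists n, 0 < powm Q n i0 j) ->
  prob_vector u -> (forall j, 0 < u j -> 0 < pi j) ->
  cvg1 (fun t => mulmv (semigroup G t) u) +oo pi.
Proof.
move=> Qd ppi Qpi reach pu supp; apply/cvg1P => e e0.
have lpi := prob_l1 ppi; have lu := prob_l1 pu.
pose x i := u i - pi i; have lx : l1 x by exact: l1B.
have e20 : 0 < e / 2 by rewrite divr_gt0.
have [N HN] := powm_cvg_stationary sQ Qd ppi Qpi reach pu supp e20.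
pose A := fine (norm1 x).
have A0 : 0 <= A by rewrite fine_ge0// norm1_ge0.
pose C := \sum_(n < N) n.+1%:R : R.
have C0 : 0 <= C by apply: sumr_ge0.
(* From [t0] on, [A * C / (lam * t) <= e / 2]; the summand 1 keeps [t] positive. *)
pose t0 := A * C / (e / 2) / lam + 1.
near=> t.
have t0t : t0 <= t by near: t; apply: nbhs_pinfty_ge; exact: num_real.
have t_gt0 : 0 < t.
  apply: lt_le_trans t0t; apply: (@lt_le_trans _ _ 1) => //.
  rewrite lerDr; apply: divr_ge0; last exact: ltW.
  by apply: divr_ge0; [exact: mulr_ge0|exact: ltW].
set s := lam * t; have s0 : 0 < s by rewrite mulr_gt0.
have pp : prob_vector (poisson s) by exact: poisson_prob (ltW s0).
have lp := prob_l1 pp.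
rewrite (_ : _ \- _ = mulmv (mixture (poisson s) (powm Q)) x); last first.
  rewrite -semigroup_mixture mulmvB//; last exact/stochastic_semigroup/ltW.
  by rewrite (semigroup_fix (ltW t_gt0) lpi Qpi).
apply: le_trans (norm1_mulmv_mixture_le pp sP lx) _.
pose w n := if (n < N)%N then poisson s n else 0.
have w0 n : 0 <= w n by rewrite /w; case: ifP => // _; exact: pp.1.
have wN n : (N <= n)%N -> w n = 0 by rewrite /w ltnNge => ->.
have lw : l1 w by apply: l1_le lp => n; rewrite /w; case: ifP; rewrite ?normr0.
pose f n := e / 2 * poisson s n + A * w n.
have lf : l1 f by apply: l1D; exact: l1Z.
have f0 n : 0 <= f n.
  apply: addr_ge0; last exact: mulr_ge0.
  by apply: mulr_ge0; [exact: ltW|exact: pp.1].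
apply: (@le_trans _ _ (\tsum_n (f n)%:E)).
  apply: le_esum => n _; have ps := pp.1 n.
  have [nN|Nn] := ltnP n N.
    apply: (@le_trans _ _ ((poisson s n)%:E * A%:E)%E).
      rewrite lee_wpmul2l ?lee_fin// fineK ?norm1_fin//.
      exact: norm1_mulmv_le.
    by rewrite -EFinM lee_fin /f /w nN mulrC lerDr mulr_ge0// ltW.
  rewrite norm1E; last exact: l1_mulmv.
  rewrite -EFinM lee_fin /f wN// mulr0 addr0 mulrC ler_wpM2r//.
  apply: le_trans (HN n Nn); rewrite le_eqVlt; apply/orP; left; apply/eqP.
  by apply: eq_usum => i; rewrite mulmvB// (mulmv_powm_fix sQ n lpi Qpi).
rewrite -usumE// lee_fin /f usumD; [|exact: l1Z..].
rewrite (usumZ _ lp) (usumZ _ lw) (prob_usum pp) mulr1 (usum_ord wN).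
rewrite [leRHS](splitr e) lerD2l.
apply: (@le_trans _ _ (A * (C / s))).
  rewrite ler_wpM2l// /C mulr_suml; apply: ler_sum => n _.
  by rewrite /w ltn_ord poisson_le.
have : A * C / (e / 2) / lam <= t by apply: le_trans t0t; rewrite lerDl.
rewrite !ler_pdivrMr// => ACt; rewrite mulrA ler_pdivrMr//.
by apply: le_trans ACt _; rewrite /s mulrC [t * lam]mulrC.
Unshelve. all: by end_near. Qed.

End LongTimeLimit.

(** * Finite strongly connected subsystems *)

Section Reachability.
Context {T : eqType}.
Implicit Types (e : rel T) (a b c : T).

Definition reach e a b := exists p, path e a p /\ last a p = b.

Lemma reach_trans e a b c : reach e a b -> reach e b c -> reach e a c.
Proof.
move=> [p [ep <-]] [q [eq2 <-]]; exists (p ++ q).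
by rewrite cat_path ep eq2 last_cat.
Qed.

Lemma reach_sub e e' a b : subrel e e' -> reach e a b -> reach e' a b.
Proof. by move=> ee' [p [ep <-]]; exists p; split => //; exact: sub_path ep. Qed.

Lemma reach_cycle e o p v : path e o p -> last o p = o -> v \in p ->
  reach e o v /\ reach e v o.
Proof.
move=> ep lp /splitPr sp; case: sp ep lp => p1 p2.
rewrite -cat_rcons cat_path last_cat last_rcons => /andP[ep1 ep2] lp.
by split; [exists (rcons p1 v); rewrite last_rcons|exists p2].
Qed.

End Reachability.

Section StronglyConnectedExhaustion.
Context {R : realType} {I : countType}.
Implicit Types (gamma : I -> I -> R) (F : {fset I}).

Definition link gamma F a b := [&& a \in F, b \in F & 0 < gamma a b].

(** Fix [o] in [F] and join every element of [F] to it by a closed walk. In the set of all vertices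
    of these walks, each vertex reaches [o] and is reached from it along its own walk. *)
Lemma strongly_connected_superset gamma F : irreducible gamma ->
  exists F', (F `<=` F')%fset /\
    forall a b, a \in F' -> b \in F' -> reach (link gamma F') a b.
Proof.
move=> irr; have [F0|[ o oF]] := fset_0Vmem F.
  by rewrite F0; exists fset0; split => // a b; rewrite inE.
have loop_ex f : exists q, f \in o :: q /\
    path (fun a b => 0 < gamma a b) o q /\ last o q = o.
  have [p [ep lp]] := irr o f; have [q [eq2 lq]] := irr f o.
  exists (p ++ q); rewrite cat_path last_cat lp ep eq2 lq; split=> //.
  by rewrite -cat_cons mem_cat -lp mem_last.
have [L HL] := choice loop_ex.
pose s := o :: flatten [seq L f | f <- F].
pose F' := [fset v in s]%fset.
have F'E v : (v \in F') = (v \in s) by rewrite !inE.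
have LF' f : f \in F -> {subset L f <= F'}.
  move=> fF v vL; rewrite F'E inE; apply/orP; right.
  by apply/flatten_mapP; exists f.
have oF' : o \in F' by rewrite F'E mem_head.
have loopF f : f \in F -> path (link gamma F') o (L f).
  move=> fF; have [_ [pL _]] := HL f.
  apply: (@sub_in_path _ (mem F') _ _ _ _ _ _ pL).
    by move=> a b aF bF ab; apply/and3P.
  apply/allP => v; rewrite inE => /orP[/eqP ->|/(LF' f fF)//]; exact: oF'.
have both v : v \in F' ->
    reach (link gamma F') o v /\ reach (link gamma F') v o.
  rewrite F'E inE => /orP[/eqP ->|]; first by split; exists [::].
  move=> /flatten_mapP[f fF vL]; apply: (reach_cycle (loopF f fF)) => //.
  by have [_ []] := HL f.
exists F'; split.
  apply/fsubsetP => f fF; have [fL _] := HL f.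
  move: fL; rewrite inE => /orP[/eqP -> //|fL].
  exact: LF' fL.
by move=> a b /both[_ ao] /both[ob _]; exact: reach_trans ao ob.
Qed.

End StronglyConnectedExhaustion.

Section StationaryVectors.
Context {R : realType} {I : countType}.
Variable Q : I -> I -> R.
Hypothesis sQ : stochastic Q.

Lemma reach_powm i j : reach (fun a b => 0 < Q b a) j i ->
  exists n, 0 < powm Q n i j.
Proof. by move=> [p [ep <-]]; exists (size p); exact: powm_path. Qed.

Lemma stationary_gt0 (pi : I -> R) i j : prob_vector pi -> mulmv Q pi = pi ->
  0 < pi j -> reach (fun a b => 0 < Q b a) j i -> 0 < pi i.
Proof.
move=> ppi Qpi pj /reach_powm[n Qn]; have lpi := prob_l1 ppi.
rewrite -(mulmv_powm_fix sQ n lpi Qpi); apply: lt_le_trans (mulr_gt0 Qn pj) _.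
by apply: mulmv_ge_term => //; [exact: stochastic_powm|exact: ppi.1].
Qed.

(** Since [|y| = |Q y| <= Q |y|] and [Q] preserves the total mass, the nonnegative difference [z]
    has sum zero and vanishes. *)
Lemma stationary_norm y : l1 y -> mulmv Q y = y ->
  mulmv Q (fun i => `|y i|) = fun i => `|y i|.
Proof.
move=> ly Qy; have la := l1_norm ly; have lQa := l1_mulmv sQ la.
pose z i := mulmv Q (fun i => `|y i|) i - `|y i|.
have z0 i : 0 <= z i.
  rewrite subr_ge0 -{1}Qy; apply: le_trans (le_norm_usum _) _.
    exact: l1_stochastic_row.
  apply: le_usum.
  - by move=> j; rewrite normrM ger0_norm// stochastic_ge0.
  - by apply: l1_norm; exact: l1_stochastic_row.
  - exact: l1_stochastic_row.
have lz : l1 z by exact: l1B.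
have uz : usum z = 0 by rewrite usumB// usum_mulmv// subrr.
apply/funext => i; apply/subr0_eq/eqP; rewrite -/(z i) eq_le z0 andbT -uz.
exact: usum_ge_term.
Qed.

End StationaryVectors.

(** Vanishing column sums put the all-ones row vector in the left kernel, so the determinant is
    zero. Applied to the transpose, the same criterion gives a right kernel vector, extended by 0
    outside [F]. *)
Lemma fset_kernel {R : fieldType} {I : choiceType} (F : {fset I})
    (G : I -> I -> R) : F != fset0 ->
  (forall j, j \in F -> \sum_(i <- F) G i j = 0) ->
  exists y : I -> R, [/\ exists i, y i != 0, forall i, i \notin F -> y i = 0
    & forall i, i \in F -> \sum_(j <- F) G i j * y j = 0].
Proof.
move=> F0 G0; pose n := #|{: F}|.
pose v (a : 'I_n) : I := val (enum_val a).
have vF a : v a \in F by exact: valP.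
have sumE (f : I -> R) : \sum_(i <- F) f i = \sum_(a < n) f (v a).
  by rewrite big_seq_fsetE/= /n big_enum_val.
pose A : 'M[R]_n := \matrix_(a, b) G (v a) (v b).
have dA : \det A == 0.
  apply/det0P; exists (const_mx 1).
    case/fset0Pn : F0 => i iF; apply/eqP => /rowP/(_ (enum_rank [` iF]%fset)).
    by rewrite !mxE => /eqP; rewrite oner_eq0.
  apply/rowP => b; rewrite !mxE -[RHS](G0 (v b) (vF b)) sumE.
  by apply: eq_bigr => a _; rewrite !mxE mul1r.
have /det0P[w w0 wA] : \det A^T == 0 by rewrite det_tr.
pose y i := if insub i is Some x then w 0 (enum_rank (x : F)) else 0.
have yv a : y (v a) = w 0 a.
  by rewrite /y /v valK enum_valK.
exists y; split.
- have [a wa] : exists a, w 0 a != 0.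
    apply/existsP; apply: contraNT w0; rewrite negb_exists => /forallP w0.
    apply/eqP/rowP => a; rewrite mxE; apply/eqP; move: (w0 a).
    by rewrite negbK.
  by exists (v a); rewrite yv.
- by move=> i iF; rewrite /y insubN.
- move=> i iF; rewrite sumE.
  have iE : i = v (enum_rank [` iF]%fset) by rewrite /v enum_rankK.
  have /rowP/(_ (enum_rank [` iF]%fset)) := wA; rewrite !mxE => wA0.
  rewrite -[RHS]wA0.
  by apply: eq_bigr => b _; rewrite !mxE yv -iE mulrC.
Qed.

(** * From a bounded generator to a lazy stochastic matrix *)

Section BoundedGenerators.
Context {R : realType} {I : countType}.
Variables (G : I -> I -> R) (lam : R).

Definition uniformized i j := (i == j)%:R + G i j / lam.

Hypothesis lam0 : 0 < lam.
Hypothesis G_off : forall i j, i != j -> 0 <= G i j.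
Hypothesis G_col : forall j, l1 (G^~ j) /\ usum (G^~ j) = 0.
(** The strict inequality is what makes the diagonal of [uniformized] positive. *)
Hypothesis G_diag : forall j, - G j j < lam.

Lemma uniformizedE i j : G i j = lam * (uniformized i j - (i == j)%:R).
Proof.
by rewrite /uniformized addrAC subrr add0r mulrCA divff ?mulr1// gt_eqF.
Qed.

Lemma uniformized_diag k : 0 < uniformized k k.
Proof.
rewrite /uniformized eqxx -ltrBlDl sub0r -ltrN2 opprK -mulNr ltr_pdivrMr// mul1r.
exact: G_diag.
Qed.

Lemma stochastic_uniformized : stochastic uniformized.
Proof.
move=> j; have [lG sG] := G_col j; have pd := @delta_prob R I j.
have lG' : l1 (fun i => lam^-1 * G i j) by exact: l1Z.
have E : uniformized^~ j = fun i => (i == j)%:R + lam^-1 * G i j.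
  by apply/funext => i; rewrite /uniformized mulrC.
apply: prob_of_usum.
- move=> i; have [->|ij] := eqVneq i j; first exact/ltW/uniformized_diag.
  by rewrite /uniformized (negbTE ij) add0r divr_ge0 ?G_off// ltW.
- by rewrite E; apply: l1D => //; exact: prob_l1.
- rewrite E usumD//; last exact: prob_l1.
  by rewrite (prob_usum pd) usumZ// sG mulr0 addr0.
Qed.

Lemma uniformized_fix x : l1 x ->
  mulmv uniformized x = x <-> mulmv G x = (fun _ => 0).
Proof.
move=> lx; have H i := mulmv_generator i stochastic_uniformized uniformizedE lx.
split=> [Ux|Gx]; apply/funext => i.
  by rewrite H Ux subrr mulr0.
apply/subr0_eq/eqP; have := H i; rewrite Gx => /esym/eqP.
by rewrite mulf_eq0 gt_eqF.
Qed.

Lemma uniformized_gt0 a b : a != b -> 0 < G b a -> 0 < uniformized b a.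
Proof.
by move=> ab Gab; rewrite /uniformized eq_sym (negbTE ab) add0r divr_gt0.
Qed.

End BoundedGenerators.

(** * The full generator and its finite subsystems *)

Section FiniteSubsystems.
Context {R : realType} {I : countType}.
Variable gamma : I -> I -> R.
Hypothesis gamma_ge0 : forall i j, 0 <= gamma i j.
Hypothesis gamma_diag : forall i, gamma i i = 0.
Hypothesis gamma_irr : irreducible gamma.
Hypothesis Gamma_summable :
  (\esum_(p in [set: I * I]) `|generator gamma p.1 p.2|%:E < +oo)%E.

Let G := generator gamma.
Let S := (\esum_(p in [set: I * I]) `|G p.1 p.2|%:E)%E.

(** Adding 1 makes the rate positive and strictly larger than every exit rate. Exit rates in a
    finite subsystem are smaller still, so the same rate serves them all. *)
Definition uniform_rate : R := fine S + 1.
Let lam := uniform_rate.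

Let S_fin : S \is a fin_num.
Proof. by rewrite ge0_fin_numE// esum_ge0. Qed.

Lemma uniform_rate_gt0 : 0 < lam.
Proof. by rewrite ltr_wpDl// fine_ge0// esum_ge0. Qed.

Let rows : (\tsum_i (norm1 (G i)) = S)%E.
Proof.
rewrite /norm1 esum_esum// /S (_ : _ `*`` _ = [set: I * I])//.
exact/seteqP.
Qed.

Let norm1_row i : (norm1 (G i) <= S)%E.
Proof.
by rewrite -rows (@esum_ge_term _ _ (fun i => norm1 (G i)))// => j; exact: norm1_ge0.
Qed.

Let rows_fin : (\tsum_i (norm1 (G i)) < +oo)%E.
Proof. by rewrite rows. Qed.

Let l1_col j : l1 (G^~ j).
Proof. exact: l1_row (l1_swap rows_fin) j. Qed.

Let G_le_S i j : `|G i j| <= fine S.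
Proof.
by rewrite -lee_fin fineK// (le_trans (norm1_coord _ _))// norm1_row.
Qed.

Let l1_gamma j : l1 (gamma j).
Proof.
apply: l1_le (l1_col j) => i; rewrite /G /generator.
by case: eqVneq => [->|//]; rewrite gamma_diag normr0.
Qed.

Let G_off i j : i != j -> 0 <= G i j.
Proof. by move=> /negbTE ij; rewrite /G /generator ij. Qed.

Let G_col j : l1 (G^~ j) /\ usum (G^~ j) = 0.
Proof.
split=> //; pose z i := if i == j then usum (gamma j) else 0.
have zj i : i != j -> z i = 0 by rewrite /z => /negbTE ->.
have lz : l1 z by apply: (@l1_fset _ _ _ [fset j]%fset) => i; rewrite inE => /zj.
rewrite (_ : G^~ j = fun i => gamma j i - z i).
  by rewrite usumB// (usum_single zj) /z eqxx subrr.
apply/funext => i; rewrite /G /generator /z.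
by case: eqVneq => [->|_]; rewrite ?gamma_diag ?sub0r ?subr0.
Qed.

Let usum_gamma_lt j : usum (gamma j) < lam.
Proof.
apply: (@le_lt_trans _ _ (fine S)); last by rewrite ltrDl.
apply: le_trans (G_le_S j j).
by rewrite /G /generator eqxx normrN ler_norm.
Qed.

Let G_diag j : - G j j < lam.
Proof. by rewrite /G /generator eqxx opprK. Qed.

Definition unif_generator := uniformized G lam.

Lemma stochastic_unif_generator : stochastic unif_generator.
Proof. exact: (stochastic_uniformized uniform_rate_gt0). Qed.

Lemma unif_generatorE i j : G i j = lam * (unif_generator i j - (i == j)%:R).
Proof. exact: uniformizedE uniform_rate_gt0 i j. Qed.

Lemma unif_generator_lazy k : 0 < unif_generator k k.
Proof. exact: uniformized_diag uniform_rate_gt0 G_diag k. Qed.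

Lemma unif_generator_fix x : l1 x ->
  mulmv unif_generator x = x <-> mulmv G x = (fun _ => 0).
Proof. exact: uniformized_fix uniform_rate_gt0 G_off G_col G_diag x. Qed.

Lemma unif_generator_reach i j :
  reach (fun a b => 0 < unif_generator b a) i j.
Proof.
have [p [gp lp]] := gamma_irr i j; apply: (@reach_sub _ (fun a b => 0 < gamma a b)).
  move=> a b ab; have ab' : a != b.
    by apply: contraTneq ab => ->; rewrite gamma_diag ltxx.
  apply: uniformized_gt0 => //; first exact: uniform_rate_gt0.
  by rewrite /G /generator eq_sym (negbTE ab').
by exists p.
Qed.

Section OneSubsystem.
Variable F : {fset I}.
Hypothesis F_conn : forall a b, a \in F -> b \in F -> reach (link gamma F) a b.
Hypothesis F_neq0 : F != fset0.

Let GF := sub_generator gamma F.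
Let QF := uniformized GF lam.

Let GF_off i j : i != j -> 0 <= GF i j.
Proof.
by move=> /negbTE ij; rewrite /GF /sub_generator ij; case: ifP.
Qed.

Let GF_row0 i j : i \notin F -> GF i j = 0.
Proof. by rewrite /GF /sub_generator => /negbTE ->. Qed.

Let GF_col_sum j : \sum_(i <- F) GF i j = 0.
Proof.
have [jF|jF] := boolP (j \in F); last first.
  by rewrite big1// => i _; rewrite /GF /sub_generator (negbTE jF) andbF.
rewrite (big_fsetD1 j)//= /GF /sub_generator jF eqxx/=.
rewrite (big_fsetD1 j)//= gamma_diag add0r addrC; apply/eqP; rewrite subr_eq0.
apply/eqP; rewrite big_seq [RHS]big_seq; apply: eq_bigr => i.
by rewrite !inE => /andP[/negbTE -> ->].
Qed.

Let GF_col j : l1 (GF^~ j) /\ usum (GF^~ j) = 0.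
Proof.
have off_F i : i \notin F -> GF i j = 0 by exact: GF_row0.
by split; [exact: l1_fset off_F|rewrite (usum_fset off_F)].
Qed.

Let GF_diag j : - GF j j < lam.
Proof.
rewrite /GF /sub_generator eqxx; case: ifP => _; last first.
  by rewrite oppr0 uniform_rate_gt0.
rewrite opprK; apply: le_lt_trans (usum_gamma_lt j).
exact: fset_le_usum.
Qed.

Let sQF : stochastic QF.
Proof. exact: (stochastic_uniformized uniform_rate_gt0). Qed.

Let QF_reach a b : a \in F -> b \in F -> reach (fun a b => 0 < QF b a) a b.
Proof.
move=> aF bF; apply: reach_sub (F_conn aF bF) => c d /and3P[cF dF cd].
have cd' : c != d by apply: contraTneq cd => ->; rewrite gamma_diag ltxx.
apply: uniformized_gt0 => //; first exact: uniform_rate_gt0.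
by rewrite /GF /sub_generator cF dF eq_sym (negbTE cd').
Qed.

(** A kernel vector of the matrix on [F] may change sign, but its absolute value is stationary too;
    normalised, it is a probability vector on [F], and strong connectivity spreads positivity to the
    whole of [F]. *)
Lemma subsystem_stationary : exists pi : I -> R,
  [/\ prob_vector pi, forall i, i \notin F -> pi i = 0,
      forall i, i \in F -> 0 < pi i & mulmv GF pi = (fun _ => 0)].
Proof.
have [y [[i yi] y0 Gy]] := fset_kernel F_neq0 (fun j _ => GF_col_sum j).
have ly : l1 y by exact: l1_fset y0.
have Gy0 : mulmv GF y = fun _ => 0.
  apply/funext => k; rewrite /mulmv (@usum_fset _ _ _ F); last first.
    by move=> j /y0 ->; rewrite mulr0.
  have [kF|kF] := boolP (k \in F); first exact: Gy.
  by apply: big1 => j _; rewrite GF_row0// mul0r.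
have fixP x lx := uniformized_fix uniform_rate_gt0 GF_off GF_col GF_diag (x := x) lx.
have Qy : mulmv QF y = y by exact/(fixP y ly).
have la := l1_norm ly.
pose m := usum (fun i => `|y i|).
have m0 : 0 < m.
  apply: lt_le_trans (_ : `|y i| <= m); first by rewrite normr_gt0.
  exact: (@usum_ge_term _ _ (fun i => `|y i|)).
pose pi j := m^-1 * `|y j|.
have lpi : l1 pi by exact: l1Z.
have ppi : prob_vector pi.
  apply: prob_of_usum => //.
    by move=> j; rewrite mulr_ge0// invr_ge0 ltW.
  by rewrite usumZ// -/m mulVf// gt_eqF.
have Qpi : mulmv QF pi = pi by rewrite mulmvZ// stationary_norm.
have piF j : j \notin F -> pi j = 0 by move=> /y0 yj; rewrite /pi yj normr0 mulr0.
exists pi; split => //; last exact/(fixP pi lpi).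
move=> j jF; have [k pik] := prob_exists_gt0 ppi.
have kF : k \in F by apply: contraTT pik => /piF ->; rewrite ltxx.
exact: (stationary_gt0 sQF ppi Qpi pik (QF_reach kF jF)).
Qed.

(** The stationary vector charges all of [F], hence the support of the conditioned vector, so
    [semigroup_cvg] applies. It shows that the limit in [limiting_state] exists and equals this
    stationary vector. *)
Lemma subsystem_limiting_state (P0 : I -> R) : (forall i, 0 <= P0 i) ->
  0 < mass P0 F ->
  let pi := limiting_state gamma F (conditioned P0 F) in
  [/\ prob_vector pi, forall i, i \notin F -> pi i = 0
    & mulmv GF pi = (fun _ => 0)].
Proof.
move=> P00 mF pi'; have [pi [ppi piF pi_gt0 Gpi]] := subsystem_stationary.
suff -> : pi' = pi by [].
have lpi := prob_l1 ppi.
pose u := conditioned P0 F.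
have u0 i : i \notin F -> u i = 0 by rewrite /u /conditioned => /negbTE ->.
have pu : prob_vector u.
  apply: prob_of_usum; last 1 first.
  - rewrite (usum_fset u0) (_ : \sum_(i <- F) u i = \sum_(i <- F) P0 i / mass P0 F).
      by rewrite -mulr_suml divff// gt_eqF.
    by apply: eq_big_seq => i iF; rewrite /u /conditioned iF.
  - by move=> i; rewrite /u /conditioned; case: ifP => // _; rewrite divr_ge0// ltW.
  - exact: l1_fset u0.
have [i0 i0F] := fset0Pn _ F_neq0.
have piP j : 0 < pi j -> j \in F.
  by apply: contraTT => /piF ->; rewrite ltxx.
have Qpi : mulmv QF pi = pi.
  by apply/(uniformized_fix uniform_rate_gt0 GF_off GF_col GF_diag lpi).
have /cvg1P cv : cvg1 (fun t => mulmv (semigroup GF t) u) +oo pi.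
  apply: (@semigroup_cvg _ _ QF lam GF sQF uniform_rate_gt0 _ pi u i0) => //.
  - exact: uniformizedE uniform_rate_gt0.
  - exact: uniformized_diag uniform_rate_gt0 GF_diag.
  - by move=> j /piP jF; apply: reach_powm => //; exact: QF_reach.
  - move=> j uj; apply: pi_gt0; apply: contraTT uj => /u0 ->.
    by rewrite ltxx.
apply/funext => i; rewrite /pi' /limiting_state; apply: cvg_lim => //.
apply/cvgrPdist_le => e e0; apply: filterS (cv e e0) => t te.
by rewrite distrC -lee_fin (le_trans _ te)// (norm1_coord (_ \- _)).
Qed.

End OneSubsystem.

(** Let [pi] be the limiting state of a large strongly connected [F]. On row [i] the matrices [G]
    and [GF] differ within [F] only on the diagonal, so [G P] at [i] is [G (P - pi)] plus a diagonal
    correction: the first is small because [pi] is close to [P], the second because the rate of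
    leaving [F] from [i] is small. *)
Lemma limit_stationary (P0 P : I -> R) : prob_vector P0 -> prob_vector P ->
  limiting_states_cvg gamma P0 P -> mulmv G P = (fun _ => 0).
Proof.
move=> pP0 pP /cvg1P cv; have lP := prob_l1 pP.
apply/funext => i; apply/eqP; rewrite -normr_le0; apply/ler_addgt0Pl => e e0.
rewrite addr0.
(* Chosen so that [e = fine S * d + d], one summand for each of the two errors. *)
pose d := e / (fine S + 1).
have d0 : 0 < d by rewrite divr_gt0// uniform_rate_gt0.
have [F1 _ HF1] := cv d d0.
have [F2 HF2] := usum_tail (gamma_ge0 i) (l1_gamma i) d0.
have [a P0a] := prob_exists_gt0 pP0.
(* The state [a] gives [F] positive mass, [i] puts row [i] inside [F], [F1] brings [pi] close to
   [P], and [F2] bounds the rate of leaving [F] from [i]. *)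
have [F [subF F_conn]] :=
  strongly_connected_superset ([fset a; i] `|` (F1 `|` F2))%fset gamma_irr.
have aF : a \in F by apply: (fsubsetP subF); rewrite !inE eqxx.
have iF : i \in F by apply: (fsubsetP subF); rewrite !inE eqxx orbT.
have F1F : (F1 `<=` F)%fset.
  by apply: fsubset_trans subF; rewrite fsubsetU// fsubsetUl orbT.
have F2F : (F2 `<=` F)%fset.
  by apply: fsubset_trans subF; rewrite fsubsetU// fsubsetUr orbT.
have F0 : F != fset0 by apply/fset0Pn; exists a.
have mF : 0 < mass P0 F.
  rewrite /mass (big_fsetD1 a)//= ltr_pwDl// sumr_ge0// => j _.
  exact: pP0.1.
have Fd := HF1 F F1F mF.
have [] := subsystem_limiting_state F_conn F0 pP0.1 mF.
move: Fd; set pi := limiting_state gamma F _ => Fd ppi piF GFpi.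
have lpi := prob_l1 ppi.
have lG x : l1 x -> l1 (fun j => G i j * x j).
  move=> lx; apply: (l1_le (Y := fun j => fine S * x j)); last exact: l1Z.
  move=> j; rewrite !normrM ler_wpM2r// (le_trans (G_le_S i j))// ler_norm//.
have lD : l1 (fun j => P j - pi j) by exact: l1B.
pose GF := sub_generator gamma F.
have lGF : l1 (fun j => GF i j * pi j).
  by apply: (l1_fset (F := F)) => j /piF ->; rewrite mulr0.
have uGF : usum (fun j => GF i j * pi j) = 0 := congr1 (fun f => f i) GFpi.
pose z j := if j == i then (G i i - GF i i) * pi i else 0.
have zi j : j != i -> z j = 0 by rewrite /z => /negbTE ->.
have lz : l1 z by apply: (l1_fset (F := [fset i]%fset)) => j; rewrite inE => /zi.
have -> : mulmv G P i = usum (fun j => G i j * (P j - pi j)) + usum z.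
  rewrite -[RHS]addr0 -uGF -usumD//; last exact: lG.
  rewrite -usumD//; last by apply: l1D => //; exact: lG.
  apply: eq_usum => j; rewrite /z; case: eqVneq => [->|ji]; first by ring.
  have [jF|/piF ->] := boolP (j \in F); last by ring.
  rewrite /GF /sub_generator /G /generator iF jF/= eq_sym (negbTE ji); ring.
rewrite (usum_single zi) (le_trans (ler_normD _ _))//.
have -> : e = fine S * d + d by rewrite /d; field; rewrite gt_eqF// uniform_rate_gt0.
have lGD := lG _ lD.
apply: lerD.
  apply: le_trans (le_norm_usum lGD) _.
  apply: (@le_trans _ _ (usum (fun j => fine S * `|P j - pi j|))).
    apply: le_usum; [|exact: l1_norm|by apply: l1Z; exact: l1_norm].
    by move=> j; rewrite normrM ler_wpM2r.
  rewrite usumZ; last exact: l1_norm.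
  rewrite ler_wpM2l ?fine_ge0 ?esum_ge0// -lee_fin -norm1E//.
  by apply: le_trans Fd; apply: le_norm1 => j; rewrite /= [leRHS]distrC.
rewrite /z eqxx normrM (@le_trans _ _ (`|G i i - GF i i| * 1))//.
  by rewrite ler_wpM2l// ger0_norm; [exact: prob_le1|exact: ppi.1].
rewrite mulr1 /G /GF /generator /sub_generator eqxx iF/= opprK addrC distrC.
by rewrite ger0_norm ?HF2// subr_ge0 fset_le_usum.
Qed.

End FiniteSubsystems.

(** * Positive recurrence *)

Section Avoidance.
Context {R : realType} {I : countType}.
Variables (K : I -> I -> R) (w0 : I).
Hypothesis sK : stochastic K.

(* The probability that the chain started at j is not at w0 at any of the
   times 1, ..., m. *)
Fixpoint avoid (m : nat) (j : I) : R :=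
  if m is m'.+1 then usum (fun i => if i == w0 then 0 else avoid m' i * K i j)
  else 1.

Lemma avoid_bounds m j : 0 <= avoid m j <= 1.
Proof.
elim: m j => [|m ih] j /=; first by rewrite ler01 lexx.
have K0 i := stochastic_ge0 i j sK.
have av0 i : 0 <= avoid m i by case/andP: (ih i).
have av1 i : avoid m i <= 1 by case/andP: (ih i).
pose f i := if i == w0 then 0 else avoid m i * K i j.
have f0 i : 0 <= f i by rewrite /f; case: ifP => // _; rewrite mulr_ge0.
have fK i : f i <= K i j by rewrite /f; case: ifP => // _; rewrite ler_piMl.
have lK : l1 (K^~ j) by exact: prob_l1 (sK j).
have lf : l1 f by apply: l1_le lK => i; rewrite !ger0_norm.
by rewrite usum_ge0//= -(prob_usum (sK j)); exact: le_usum.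
Qed.

Lemma avoid_ge0 m j : 0 <= avoid m j.
Proof. by case/andP: (avoid_bounds m j). Qed.

Lemma avoid_le1 m j : avoid m j <= 1.
Proof. by case/andP: (avoid_bounds m j). Qed.

Lemma l1_avoid_step m j : l1 (fun i => if i == w0 then 0 else avoid m i * K i j).
Proof.
apply: l1_le (prob_l1 (sK j)) => i; case: ifP => _; first by rewrite normr0.
by rewrite normrM ler_piMl// ger0_norm ?avoid_ge0 ?avoid_le1.
Qed.

Variable pi : I -> R.
Hypothesis pi_prob : prob_vector pi.
Hypothesis Kpi : mulmv K pi = pi.

Let lpi : l1 pi. Proof. exact: prob_l1. Qed.

Let l1_pi_avoid m : l1 (fun j => pi j * avoid m j).
Proof.
apply: l1_le lpi => j; rewrite normrM ler_piMr// ger0_norm ?avoid_ge0//.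
exact: avoid_le1.
Qed.

(* The chain started from its stationary distribution and shifted by one
   step is again stationary. *)
Lemma stationary_avoidS m :
  usum (fun j => pi j * avoid m.+1 j) + pi w0 * avoid m w0 =
  usum (fun j => pi j * avoid m j).
Proof.
pose f i j := if i == w0 then 0 else avoid m i * (K i j * pi j).
have S : (\tsum_j (norm1 (f^~ j)) < +oo)%E.
  apply: le_lt_trans lpi; rewrite -(norm1_stochastic_col sK).
  apply: le_esum => j _; apply: le_norm1 => i; rewrite /f.
  case: ifP => _; first by rewrite normr0.
  by rewrite normrM ler_piMl// ger0_norm ?avoid_ge0 ?avoid_le1.
have -> : usum (fun j => pi j * avoid m.+1 j) =
    usum (fun j => usum (fun i => f i j)).
  apply: eq_usum => j /=; rewrite -usumZ; last exact: l1_avoid_step.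
  apply: eq_usum => i; rewrite /f; case: ifP => _; first by rewrite mulr0.
  by ring.
rewrite exchange_usum//.
(* [g] restores the summand [i = w0] that [f] leaves out. *)
pose g i := if i == w0 then pi i * avoid m i else 0.
have gi i : i != w0 -> g i = 0 by rewrite /g => /negbTE ->.
have lg : l1 g by apply: (l1_fset (F := [fset w0]%fset)) => j; rewrite inE => /gi.
have -> : pi w0 * avoid m w0 = usum g by rewrite (usum_single gi) /g eqxx.
rewrite -usumD//; last exact: l1_usum (l1_swap S).
apply: eq_usum => i; rewrite /f /g; case: eqVneq => [->|_].
  by rewrite (@usum_fset _ _ _ fset0) ?big_seq_fset0 ?add0r.
rewrite addr0 usumZ; last exact: l1_stochastic_row.
by rewrite -/(mulmv K pi i) Kpi mulrC.
Qed.

(** The identity [stationary_avoidS] telescopes from total mass 1, and the remaining term at [M] is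
    nonnegative. *)
Lemma sum_avoid_le M : pi w0 * \sum_(0 <= m < M) avoid m w0 <= 1.
Proof.
have E : pi w0 * \sum_(0 <= m < M) avoid m w0 + usum (fun j => pi j * avoid M j) = 1.
  elim: M => [|M ih].
    rewrite big_geq// mulr0 add0r -(prob_usum pi_prob).
    by apply: eq_usum => j; rewrite mulr1.
  rewrite big_nat_recr//= mulrDr -addrA [X in _ + X]addrC.
  rewrite -[X in _ + (X + _)]/(usum (fun j => pi j * avoid M.+1 j)).
  by rewrite stationary_avoidS.
rewrite -E lerDl; apply: usum_ge0; last exact: l1_pi_avoid.
by move=> j; rewrite mulr_ge0 ?avoid_ge0//; exact: pi_prob.1.
Qed.

Lemma l1_avoid : 0 < pi w0 -> l1 (fun m => avoid m w0).
Proof.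
move=> pi0; apply: (@l1_series _ _ (pi w0)^-1) => M.
rewrite -[leRHS]mulr1 ler_pdivlMl// (le_trans _ (sum_avoid_le M))//.
by rewrite ler_pM2l// ler_sum// => m _; rewrite ger0_norm ?avoid_ge0.
Qed.

End Avoidance.

Section MeasureAux.
Context {R : realType}.

(* Measurability is not assumed, because the return time of a chain is not
   known to be measurable. *)
Lemma le_integralT_ge0 d (T : measurableType d) (mu : {measure set T -> \bar R})
    (f g : T -> \bar R) :
  (forall x, (0 <= f x)%E) -> (forall x, (f x <= g x)%E) ->
  (\int[mu]_x f x <= \int[mu]_x g x)%E.
Proof.
move=> f0 fg; rewrite !ge0_integralTE//; last first.
  by move=> x; exact: le_trans (f0 x) (fg x).
apply: le_ereal_sup => _ [h /= hf <-]; exists h => //= x.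
exact: le_trans (hf x) (fg x).
Qed.

(** Countable additivity is available for sequences, so the fibers are indexed by the codes of [I],
    a number that codes no element being given the empty set. *)
Lemma measure_fibers d (T : measurableType d) (mu : {measure set T -> \bar R})
    (I : countType) (f : T -> I) (B : set T) :
  (forall i, measurable (f @^-1` [set i])) -> measurable B ->
  mu B = \tsum_i (mu (B `&` f @^-1` [set i])).
Proof.
move=> mf mB.
pose F n := if @choice.unpickle I n is Some i then
  (if choice.pickle i == n then B `&` f @^-1` [set i] else set0) else set0.
have FE i : F (choice.pickle i) = B `&` f @^-1` [set i].
  by rewrite /F choice.pickleK eqxx.
have F0 n : ~ range (@choice.pickle I) n -> F n = set0.
  rewrite /F; case: choice.unpickle => [i|//]; case: eqVneq => // <- [].
  by exists i.
have mF n : measurable (F n).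
  by rewrite /F; case: choice.unpickle => // i; case: ifP => // _; exact: measurableI.
have tF : trivIset [set: nat] F.
  move=> m n _ _ [x []].
  rewrite /F; case: choice.unpickle => [i|//]; case: eqVneq => // <- [_ /= <-].
  by case: choice.unpickle => [j|//]; case: eqVneq => // <- [_ /= <-].
have BE : B = \bigcup_n F n.
  apply/seteqP; split => [x Bx|x [n _]].
    by exists (choice.pickle (f x)) => //; rewrite FE.
  rewrite /F; case: choice.unpickle => [i|//]; case: ifP => // _ [].
  by [].
rewrite [LHS](congr1 mu BE) measure_semi_bigcup//; last exact: bigcupT_measurable.
rewrite nneseries_esumT//.
rewrite (eq_esum (b := fun n =>
    if n \in range (@choice.pickle I) then mu (F n) else 0%E)); last first.
  move=> n _; case: ifPn => //; rewrite notin_setE => /F0 ->.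
  by rewrite measure0.
rewrite -esum_mkcond esum_image; last first.
  by move=> i j _ _; exact: (pcan_inj choice.pickleK).
by apply: eq_esum => i _; rewrite FE.
Qed.

End MeasureAux.

(** * The chain observed at integer times *)

Section Skeleton.
Context {R : realType} {I : countType}.
Variables (G : I -> I -> R) (w0 : I).
Context {d : measure_display} {T : measurableType d}.
Variables (P : probability T R) (X : R -> T -> I).
Hypothesis chain : markov_chain G w0 P X.

Let K := semigroup G 1.
Hypothesis sK : stochastic K.

Definition history (h : seq (R * I)) : set T :=
  [set x | forall q : R * I, q \in h -> X q.1 x = q.2].

Definition skeleton_at (n : nat) (i : I) : set T := X n%:R @^-1` [set i].

Definition stays_off (n m : nat) : set T :=
  [set x | forall k, (k < m)%N -> X (n + k).+1%:R x <> w0].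

Definition before (h : seq (R * I)) (n : nat) :=
  forall q : R * I, q \in h -> 0 <= q.1 <= n%:R.

Lemma history_cons q h : history (q :: h) = X q.1 @^-1` [set q.2] `&` history h.
Proof.
apply/seteqP; split => [x Hx|x [xq Hx] q'].
  by split=> [|q' q'h]; apply: Hx; rewrite inE ?eqxx// q'h orbT.
by rewrite inE => /orP[/eqP -> //|/Hx].
Qed.

Lemma stays_offS n m :
  stays_off n m.+1 = ~` skeleton_at n.+1 w0 `&` stays_off n.+1 m.
Proof.
apply/seteqP; split => [x Hx|x [x0 Hx] [|k] km].
- by split=> [|k km]; [have := Hx 0%N isT; rewrite addn0|rewrite addSnnS; exact: Hx].
- by rewrite addn0.
- by rewrite -addSnnS; exact: Hx.
Qed.

Lemma measurable_skeleton_at n i : measurable (skeleton_at n i).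
Proof. by case: chain => mX _ _ _; apply: mX; exact: ler0n. Qed.

Lemma measurable_history h n : before h n -> measurable (history h).
Proof.
elim: h => [|q h ih] hn.
  by rewrite (_ : history [::] = setT)//; apply/seteqP; split => x.
rewrite history_cons; apply: measurableI.
  case: chain => mX _ _ _; apply: mX.
  by case/andP: (hn q (mem_head _ _)).
by apply: ih => q' q'h; apply: hn; rewrite inE q'h orbT.
Qed.

Lemma measurable_stays_off n m : measurable (stays_off n m).
Proof.
elim: m n => [|m ih] n.
  by rewrite (_ : stays_off n 0 = setT)//; apply/seteqP; split => x.
rewrite stays_offS; apply: measurableI => //.
by apply: measurableC; exact: measurable_skeleton_at.
Qed.

Lemma before_cons h n j : before h n -> before ((n%:R, j) :: h) n.+1.
Proof.
move=> hn q; rewrite inE => /orP[/eqP -> /=|/hn /andP[-> /le_trans]].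
  by rewrite ler0n ler_nat leqnSn.
by apply; rewrite ler_nat leqnSn.
Qed.

Lemma skeleton_step h n i j : before h n ->
  (P (history ((n%:R, j) :: h) `&` skeleton_at n.+1 i) =
    (K i j)%:E * P (history h `&` skeleton_at n j))%E.
Proof.
case: chain => _ _ _ markov hn.
have := markov h n%:R 1 i j (ler0n _ _) ler01 hn.
by rewrite /= natr1 history_cons [_ `&` history h]setIC.
Qed.

(** The event is split by the state [i] at time [n + 1]: [i = w0] contributes nothing, and any other
    [i] gives the factor [K i j]. The pair [(n, j)] then joins the past, so the induction must allow
    an arbitrary history [h]. *)
Lemma skeleton_avoid m h n j : before h n ->
  (P (history h `&` skeleton_at n j `&` stays_off n m) =
    (avoid K w0 m j)%:E * P (history h `&` skeleton_at n j))%E.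
Proof.
elim: m h n j => [|m ih] h n j hn.
  by rewrite (_ : stays_off n 0 = setT) ?setIT ?mul1e//; apply/seteqP; split => x.
set A := history h `&` skeleton_at n j.
have mA : measurable A.
  apply: measurableI; last exact: measurable_skeleton_at.
  exact: measurable_history hn.
rewrite (measure_fibers P (f := X n.+1%:R)); last 2 first.
- by move=> i; exact: measurable_skeleton_at.
- by apply: measurableI => //; exact: measurable_stays_off.
have PA_fin : P A \is a fin_num by exact: fin_num_measure.
rewrite -(fineK PA_fin) usumE; last 2 first.
- move=> i; case: ifP => // _.
  by rewrite mulr_ge0 ?avoid_ge0// stochastic_ge0.
- exact: l1_avoid_step.
rewrite muleC -esumZl ?fine_ge0//; last first.
  move=> i; rewrite lee_fin; case: ifP => // _.
  by rewrite mulr_ge0 ?avoid_ge0// stochastic_ge0.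
apply: eq_esum => i _; case: eqVneq => [->|iw].
  rewrite mule0 (_ : _ `&` _ = set0) ?measure0//.
  by apply/seteqP; split => // x [[_ /(_ 0%N isT)]]; rewrite addn0.
have -> : A `&` stays_off n m.+1 `&` X n.+1%:R @^-1` [set i] =
    history ((n%:R, j) :: h) `&` skeleton_at n.+1 i `&` stays_off n.+1 m.
  rewrite history_cons [_ `&` history h]setIC -/A stays_offS.
  apply/seteqP; split => x; first by move=> [[Ax [_ sx]] xi].
  move=> [[Ax xi] sx]; split => //; split => //; split=> //.
  by rewrite /skeleton_at /= xi; exact/eqP.
rewrite [LHS](ih _ _ _ (@before_cons h n j hn)).
by rewrite skeleton_step// -/A -(fineK PA_fin) -!EFinM mulrA mulrC.
Qed.

Let a := K w0 w0.

Fixpoint constant_history (k : nat) : seq (R * I) :=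
  if k is k'.+1 then (k'%:R, w0) :: constant_history k' else [::].

Lemma before_constant_history k : before (constant_history k) k.
Proof. by elim: k => [|k ih] //; exact: before_cons. Qed.

Let A k := history (constant_history k) `&` skeleton_at k w0.

Let A_prob k : P (A k) = (a ^+ k)%:E.
Proof.
elim: k => [|k ih].
  rewrite /A /= (_ : history [::] = setT); last by apply/seteqP; split => x.
  by rewrite setTI expr0; case: chain.
by rewrite /A skeleton_step -/(A k) ?ih -?EFinM ?exprS//; exact: before_constant_history.
Qed.

Let A_of_constant k x : (forall l, (l <= k)%N -> X l%:R x = w0) -> A k x.
Proof.
move=> xw; split; last exact: xw.
elim: k xw => [|k ih] xw; first by move=> q.
rewrite /= history_cons; split; first exact: xw.
by apply: ih => l lk; apply: xw; exact: leq_trans lk _.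
Qed.

(** Outside this event some integer [m <= n] is a return in the sense of [return_time]. The event
    may be larger than that of no return up to time [n], as excursions between integer times go
    unseen. *)
Definition not_returned (n : nat) : set T :=
  [set x | forall k m, (0 < k < m)%N -> (m <= n)%N ->
    X k%:R x <> w0 -> X m%:R x <> w0].

Lemma measurable_not_returned n : measurable (not_returned n).
Proof.
pose F k m := if [&& (0 < k)%N, (k < m)%N & (m <= n)%N] then
  skeleton_at k w0 `|` ~` skeleton_at m w0 else setT.
rewrite (_ : not_returned n = \bigcap_k \bigcap_m F k m).
  apply: bigcapT_measurable => k; apply: bigcapT_measurable => m.
  rewrite /F; case: ifP => // _; apply: measurableU.
    exact: measurable_skeleton_at.
  by apply: measurableC; exact: measurable_skeleton_at.
apply/seteqP; split => x.
  move=> Nx k _ m _; rewrite /F; case: ifP => // /and3P[k0 km mn].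
  have [xk|xk] := EM (X k%:R x = w0); [by left|right].
  by apply: Nx xk => //; rewrite k0.
move=> Fx k m /andP[k0 km] mn xk.
have := Fx k Logic.I m Logic.I; rewrite /F k0 km mn /= => -[//|].
by [].
Qed.

(** For a chain started at [w0], [k] is a time up to which the skeleton has stayed at [w0], with
    either [k = n] or a departure at time [k + 1]. After that departure no visit to [w0] is allowed
    up to time [n]. *)
Let not_returned_cover n : not_returned n `<=`
  ~` skeleton_at 0 w0 `|` \bigcup_(k < n.+1) (A k `&` stays_off k (n - k)).
Proof.
move=> x Nx; have [x0|x0] := EM (X 0 x = w0); [right|by left].
have [k [kn [xk xS]]] : exists k, (k <= n)%N /\
    (forall l, (l <= k)%N -> X l%:R x = w0) /\
    (k = n \/ X k.+1%:R x <> w0).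
  elim: n {Nx} => [|n [k [kn [xk xS]]]].
    by exists 0%N; split => //; split; [move=> l; rewrite leqn0 => /eqP ->|left].
  have [xk1|xk1] := EM (X k.+1%:R x = w0); last first.
    by exists k; split; [exact: leqW|split => //; right].
  case: xS => // kn'; exists n.+1; split => //; split; last by left.
  move=> l; rewrite leq_eqVlt => /orP[/eqP ->|]; first by rewrite -kn'.
  by rewrite ltnS -kn'; exact: xk.
exists k => /=; first by rewrite ltnS.
split; first exact: A_of_constant.
move=> i; rewrite ltn_subRL => kin; case: xS => [kn'|xS].
  by move: kin; rewrite kn' -{2}[n]addn0 ltn_add2l.
case: i kin => [|i] kin; first by rewrite addn0.
by apply: (Nx k.+1) => //; rewrite /= ltnS addnS ltnS leq_addr.
Qed.

Lemma not_returned_prob n : (P (not_returned n) <=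
  (\sum_(k < n.+1) a ^+ k * avoid K w0 (n - k) w0)%:E)%E.
Proof.
have mAs k : measurable (A k `&` stays_off k (n - k)).
  apply: measurableI; last exact: measurable_stays_off.
  apply: measurableI; last exact: measurable_skeleton_at.
  exact: measurable_history (@before_constant_history k).
have mC : measurable (~` skeleton_at 0 w0).
  by apply: measurableC; exact: measurable_skeleton_at.
have mU : measurable (\bigcup_(k < n.+1) (A k `&` stays_off k (n - k))).
  by apply: bigcup_measurable.
apply: le_trans (le_measure P _ _ (@not_returned_cover n)) _.
- by rewrite inE; exact: measurable_not_returned.
- by rewrite inE; exact: measurableU.
apply: le_trans (measureU2 P mC mU) _.
have PC0 : P (~` skeleton_at 0 w0) = 0%E.
  rewrite probability_setC; last exact: measurable_skeleton_at.
  by case: chain => _ _ -> _; rewrite subee.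
rewrite [X in (X + _ <= _)%E]PC0 add0e bigcup_mkord.
apply: le_trans (le_mu_bigsetU P (fun k _ => mAs k)) _.
rewrite -sumEFin; apply: lee_sum => k _.
rewrite [X in (X <= _)%E](skeleton_avoid _ _ (@before_constant_history k)).
by rewrite -/(A k) A_prob -EFinM mulrC.
Qed.

Lemma return_time_ge0 x : (0 <= return_time X w0 x)%E.
Proof. by apply: le_ereal_inf_tmp => _ [t /= [t0 _ _] <-]; rewrite lee_fin ltW. Qed.

(** The tail-sum form of the first integer time at which the skeleton shows a return. *)
Definition skeleton_bound (x : T) : \bar R :=
  (\sum_(0 <= n <oo) (\1_(not_returned n) x)%:E)%E.

(** If [M] is the least [n] at which [not_returned] fails, the sum is at least [M], and the failure
    exhibits a return at some [m <= M]. If it never fails, the sum is infinite. *)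
Lemma return_time_le_skeleton x : (return_time X w0 x <= skeleton_bound x)%E.
Proof.
have lb M : (forall n, (n < M)%N -> not_returned n x) ->
    (M%:R%:E <= skeleton_bound x)%E.
  move=> NM; apply: (@le_trans _ _ (\sum_(0 <= n < M) (\1_(not_returned n) x)%:E)%E).
    rewrite (eq_big_nat _ _ (F2 := fun=> 1%E)).
      by rewrite sumEFin big_const_nat subn0 iter_addr_0.
    by move=> n /andP[_ nM]; rewrite indicE mem_set//; exact: NM.
  by apply: nneseries_lim_ge => n _; rewrite lee_fin.
have [Nx|] := EM (forall n, not_returned n x).
  suff -> : skeleton_bound x = +oo%E by rewrite leey.
  apply/eq_infty => r; apply: le_trans (lb (Num.bound `|r|) _) => //.
  by rewrite lee_fin (le_trans (ler_norm r))// ltW// archi_boundP.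
move=> /existsNP[n0 n0x].
have ex : exists n, `[< ~ not_returned n x >] by exists n0; exact/asboolP.
case: (ex_minnP ex) => M /asboolP Mx Mmin.
have {Mmin} NM n : (n < M)%N -> not_returned n x.
  move=> nM; apply: contrapT => /asboolP /Mmin.
  by rewrite leqNgt nM.
apply: le_trans (lb M NM).
have [k [m [/andP[k0 km] mM xk xm]]] : exists k m,
    [/\ (0 < k < m)%N, (m <= M)%N, X k%:R x <> w0 & X m%:R x = w0].
  apply: contrapT => H; apply: Mx => k m km mM xk xm; apply: H.
  by exists k, m.
apply: (@le_trans _ _ m%:R%:E); last by rewrite lee_fin ler_nat.
apply: ereal_inf_lbound; exists m%:R => //=; split => //.
  by rewrite ltr0n (leq_trans _ km).
by exists k%:R => //; rewrite ltr0n k0 ltr_nat.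
Qed.

(** Integrated term by term, the bounds of [not_returned_prob] form the Cauchy product of a
    geometric series, for the wait at [w0], and the summable avoidance probabilities. *)
Lemma skeleton_bound_integral :
  0 <= a < 1 -> l1 (fun m => avoid K w0 m w0) ->
  (\int[P]_x skeleton_bound x < +oo)%E.
Proof.
move=> /andP[a0 a1] lav.
rewrite integral_nneseries//; last first.
  by move=> n; apply/measurable_EFinP; exact/measurable_indic/measurable_not_returned.
pose f n k := shift k (fun m => a ^+ k * avoid K w0 m w0) n.
have f0 n k : 0 <= f n k.
  by rewrite /f /shift; case: ifP => // _; rewrite mulr_ge0 ?exprn_ge0 ?avoid_ge0.
rewrite nneseries_esumT; last by move=> n; apply: integral_ge0 => x _; rewrite lee_fin.
apply: (@le_lt_trans _ _ (\tsum_n (norm1 (f n)))).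
  apply: le_esum => n _.
  rewrite integral_indic//; last exact: measurable_not_returned.
  rewrite setIT; apply: le_trans (not_returned_prob n) _.
  have fn k : (n.+1 <= k)%N -> f n k = 0.
    by rewrite /f /shift ltnNge => /negbTE ->.
  have lf : l1 (f n) := l1_ord fn.
  rewrite ge0_norm1// -usumE// (usum_ord fn) lee_fin ler_sum// => k _.
  by rewrite /f /shift -ltnS ltn_ord.
rewrite exchange_esum//.
rewrite (eq_esum (b := fun k =>
    (fine (norm1 (fun m => avoid K w0 m w0)))%:E * `|a ^+ k|%:E)%E).
  rewrite esumZl ?fine_ge0 ?norm1_ge0// -/(norm1 (fun k => a ^+ k)).
  by rewrite -(fineK (norm1_fin (l1_geometric a0 a1))) ltry.
by move=> k _; rewrite -/(norm1 (f^~ k)) norm1_shift norm1Z fineK ?norm1_fin// muleC.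
Qed.

Lemma skeleton_recurrent : 0 <= a < 1 -> l1 (fun m => avoid K w0 m w0) ->
  {ae P, forall x, (return_time X w0 x < +oo)%E} /\
  (\int[P]_x return_time X w0 x < +oo)%E.
Proof.
move=> a01 lav; have Ig := skeleton_bound_integral a01 lav.
have g0 x : (0 <= skeleton_bound x)%E by apply: nneseries_ge0 => n _ _; rewrite lee_fin.
split; last first.
  apply: le_lt_trans Ig; apply: le_integralT_ge0; first exact: return_time_ge0.
  exact: return_time_le_skeleton.
have ig : P.-integrable setT skeleton_bound.
  apply/integrableP; split.
    apply: ge0_emeasurable_sum => n; first by move=> *; rewrite lee_fin.
    by move=> _; apply/measurable_EFinP; exact/measurable_indic/measurable_not_returned.
  by rewrite (eq_integral skeleton_bound)// => x _; rewrite gee0_abs.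
have := integrable_ae measurableT ig; apply: filterS => x /(_ Logic.I) gx.
apply: le_lt_trans (return_time_le_skeleton x) _.
by rewrite ltey_eq gx.
Qed.

End Skeleton.

(** * Stationarity, uniqueness of the limit and positive recurrence of the full system *)

Theorem theorem17 (R : realType) (Omega : countType)
    (gamma : Omega -> Omega -> R)
    (Omega_infinite : infinite_set [set: Omega])
    (gamma_ge0 : forall i j, 0 <= gamma i j)
    (gamma_diag : forall i, gamma i i = 0)
    (gamma_irr : irreducible gamma)
    (Gamma_summable :
      (\esum_(p in [set: Omega * Omega]) `|generator gamma p.1 p.2|%:E < +oo)%E)
    (subsystems_cvg : forall P0 : Omega -> R, prob_vector P0 ->
      exists Pstar : Omega -> R,
        prob_vector Pstar /\ limiting_states_cvg gamma P0 Pstar) :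
  positive_recurrent (generator gamma) /\
  exists Pstar : Omega -> R,
    [/\ prob_vector Pstar,
        mulmv (generator gamma) Pstar = (fun _ => 0)
      & forall P0 : Omega -> R, prob_vector P0 ->
          limiting_states_cvg gamma P0 Pstar /\
          cvg1 (fun t : R => mulmv (semigroup (generator gamma) t) P0) +oo Pstar].
Proof.
have [ o _] := infinite_setN0 Omega_infinite.
have stationary P0 P : prob_vector P0 -> prob_vector P ->
    limiting_states_cvg gamma P0 P -> mulmv (generator gamma) P = (fun _ => 0).
  exact: limit_stationary.
have sQ := stochastic_unif_generator gamma_ge0 gamma_diag Gamma_summable.
have lazyQ := unif_generator_lazy Gamma_summable.
have reachQ := unif_generator_reach gamma_diag gamma_irr.
have genE := unif_generatorE gamma.
have lam0 := uniform_rate_gt0 gamma.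
have fixP P (lP : l1 P) := unif_generator_fix gamma_ge0 gamma_diag Gamma_summable lP.
have [pi [ppi Lpi]] := subsystems_cvg _ (delta_prob o).
have lpi := prob_l1 ppi.
have Gpi := stationary _ _ (delta_prob o) ppi Lpi.
have Qpi := (fixP pi lpi).2 Gpi.
(* Full support makes the domination condition of [semigroup_cvg] hold for every initial vector. *)
have pi_gt0 i : 0 < pi i.
  have [j pj] := prob_exists_gt0 ppi.
  exact: (stationary_gt0 sQ ppi Qpi pj (reachQ _ _)).
have limit P0 : prob_vector P0 ->
    cvg1 (fun t => mulmv (semigroup (generator gamma) t) P0) +oo pi.
  move=> pP0; apply: (semigroup_cvg sQ lam0 genE (i0 := o)) => // j _.
  exact: reach_powm.
split; last first.
  exists pi; split => // P0 pP0; split; last exact: limit.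
  (* The net for [P0] has some limit [P], again stationary; its orbit is constant and also tends to
     [pi], so [P] is [pi]. *)
  have [P [pP LP]] := subsystems_cvg _ pP0.
  have QP := (fixP P (prob_l1 pP)).2 (stationary _ _ pP0 pP LP).
  rewrite -(@cvg1_cst_unique _ _ P _ _ _ (limit P pP))// => t t0.
  exact: (semigroup_fix sQ lam0 genE t0 (prob_l1 pP) QP).
move=> w0 d T P X chain.
have sK := stochastic_semigroup sQ lam0 genE ler01.
have Kpi := semigroup_fix sQ lam0 genE ler01 lpi Qpi.
apply: (skeleton_recurrent chain sK).
- rewrite stochastic_ge0//=.
  (* The skeleton leaves [w0] in one step with positive probability: some power of the uniformized
     matrix leads from [w0] to another state, and its Poisson weight is positive. *)
  have [i iw] : exists i, i != w0.
    apply: contrapT => /forallNP H; apply: Omega_infinite.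
    apply: (sub_finite_set _ (finite_set1 w0)) => i _ /=.
    by apply/eqP; have /negP := H i; rewrite negbK.
  apply: (stochastic_diag_lt1 sK iw).
  have [n Qn] := reach_powm sQ (reachQ w0 i).
  rewrite (semigroup_mixture sQ genE) mulr1.
  apply: (@mixture_gt0 _ _ _ _ _ _ n) => //.
  + exact: poisson_prob (ltW lam0).
  + by move=> m; exact: stochastic_powm.
  + exact: poisson_gt0.
- exact: (l1_avoid sK ppi Kpi (pi_gt0 w0)).
Qed.
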